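(* Let $k \ge 8$ be a fixed integer. The $k$-colour bipartite Ramsey number of the cycle $C_{2n}$ of order $2n$ is at most $\left(2k-3.5+\frac{1}{k-2}+o(1)\right)n$, and likewise the $k$-colour bipartite Ramsey number of the path $P_{2n}$ of order $2n$ is at most $\left(2k-3.5+\frac{1}{k-2}+o(1)\right)n$, where $o(1)$ denotes a quantity tending to $0$ as $n \to \infty$ (with $k$ fixed).
   Context: The $k$-colour bipartite Ramsey number of a bipartite graph $H$ is the least integer $N$ such that every $k$-edge-colouring of the complete bipartite graph $K_{N,N}$ contains a monochromatic copy of $H$. The order of a path or cycle is its number of vertices. *)

(* Defs.v *)
From mathcomp Require Import all_boot.

Set Implicit Arguments.
Unset Strict Implicit.
Unset Printing Implicit Defensive.

Record sgraph := SGraph {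
  vertex :> finType;
  edge : rel vertex;
  edge_sym : symmetric edge;
  edge_irrefl : irreflexive edge }.

(* [X] is one of the two vertex classes: every edge has exactly one end in it. *)
Definition bipartition (H : sgraph) (X : {set H}) :=
  [forall x, forall y, edge x y ==> ((x \in X) != (y \in X))].

Record bip_graph := BipGraph {
  bip_sgraph :> sgraph;
  bip_graphP : exists X : {set bip_sgraph}, bipartition X }.

(* A copy of [H] in [G] is a subgraph of [G], not necessarily induced,
   isomorphic to [H]. *)
Definition has_copy (H G : sgraph) :=
  [exists f : {ffun H -> G},
     injectiveb f && [forall x, forall y, edge x y ==> edge (f x) (f y)]].

(* K_{N,N} has vertex classes [inl] and [inr] of 'I_N + 'I_N, and the pair
   (x, y) stands for its edge between [inl x] and [inr y]. *)
Definition edge_colouring (k N : nat) := {ffun 'I_N * 'I_N -> 'I_k}.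

Section ColourClass.
Variables (k N : nat) (c : edge_colouring k N) (i : 'I_k).

Definition colour_edge : rel ('I_N + 'I_N) := fun u v =>
  match u, v with
  | inl x, inr y => c (x, y) == i
  | inr y, inl x => c (x, y) == i
  | _, _ => false
  end.

Lemma colour_edge_sym : symmetric colour_edge.
Proof. by case=> [x|x] [y|y]. Qed.

Lemma colour_edge_irrefl : irreflexive colour_edge.
Proof. by case. Qed.

Definition colour_class := SGraph colour_edge_sym colour_edge_irrefl.
End ColourClass.

Definition bip_arrows (k : nat) (H : sgraph) (N : nat) :=
  [forall c : edge_colouring k N, exists i, has_copy H (colour_class c i)].

Lemma fiber_pigeonhole (T U : finType) (f : T -> U) m :
  #|U| * m < #|T| -> exists u, m <= #|[set t | f t == u]|.
Proof.
move=> h; apply/existsP; apply: contraLR h; rewrite negb_exists => /forallP h.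
rewrite -leqNgt -cardsT -sum1_card (partition_big f xpredT) //=.
rewrite -sum_nat_const; apply: leq_sum => u _.
rewrite sum1dep_card; move: (h u); rewrite -ltnNge => /ltnW.
by apply: leq_trans; apply: subset_leq_card; apply/subsetP => t; rewrite !inE.
Qed.

Lemma enum_injection (V T : finType) (A : {set T}) :
  #|V| <= #|A| -> exists2 g : V -> T, injective g & forall v, g v \in A.
Proof.
move=> h; exists (fun v => enum_val (widen_ord h (enum_rank v))).
  by move=> v w /enum_val_inj/(congr1 val)/= /val_inj/enum_rank_inj.
by move=> v; apply: enum_valP.
Qed.

Lemma bip_arrows_ex k (H : bip_graph) : exists N, bip_arrows k H N.
Proof.
have [X /forallP bX] := bip_graphP H.
set m := #|H|; pose M := (k * m).+1; pose N := M + (k ^ M * m).+1.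
exists N; apply/forallP => c.
have leMN : M <= N by apply: leq_addr.
pose col (y : 'I_N) := [ffun x : 'I_M => c (widen_ord leMN x, y)].
have [|v hv] := @fiber_pigeonhole _ _ col m.
  by rewrite card_ffun !card_ord /N addnS ltnS leq_addl.
have [|i hi] := @fiber_pigeonhole _ _ v m; first by rewrite !card_ord.
have [l linj lP] := enum_injection hi; have [r rinj rP] := enum_injection hv.
have lrP x y : c (widen_ord leMN (l x), r y) == i.
  move: (lP x) (rP y); rewrite !inE => /eqP <- /eqP <-; by rewrite ffunE.
apply/existsP; exists i; apply/existsP.
exists [ffun x => if x \in X then inl (widen_ord leMN (l x)) else inr (r x)].
apply/andP; split.
  apply/injectiveP => x y; rewrite !ffunE.
  case: ifP => _; case: ifP => _ // [].
    by move=> e; apply/linj/val_inj.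
  by move/rinj.
apply/forallP => x; apply/forallP => y; apply/implyP => exy.
have /forallP/(_ y)/implyP/(_ exy) := bX x.
by rewrite !ffunE; case: (x \in X); case: (y \in X) => //= _; apply: lrP.
Qed.

Definition bip_ramsey (k : nat) (H : bip_graph) : nat :=
  ex_minn (bip_arrows_ex k H).

Section PathsAndCycles.
Variable m : nat.

Definition path_edge : rel 'I_m := fun x y =>
  (y == x.+1 :> nat) || (x == y.+1 :> nat).

Lemma path_edge_sym : symmetric path_edge.
Proof. by move=> x y; rewrite /path_edge orbC. Qed.

Lemma path_edge_irrefl : irreflexive path_edge.
Proof. by move=> x; rewrite /path_edge orbb -[X in X == _]addn0 -addn1 eqn_add2l. Qed.

Definition path_graph := SGraph path_edge_sym path_edge_irrefl.

Lemma path_graph_bip : exists X : {set path_graph}, bipartition X.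
Proof.
exists [set x : 'I_m | odd x]; apply/forallP => x; apply/forallP => y.
apply/implyP; rewrite /= /path_edge !inE.
by case/orP => /eqP -> /=; case: odd.
Qed.

Definition bip_path := BipGraph path_graph_bip.

(* A cycle when [2 < m]; the conjunct [x != y] only matters when [m = 1]. *)
Definition cycle_edge : rel 'I_m := fun x y =>
  (x != y) && ((y == x.+1 %% m :> nat) || (x == y.+1 %% m :> nat)).

Lemma cycle_edge_sym : symmetric cycle_edge.
Proof. by move=> x y; rewrite /cycle_edge eq_sym orbC. Qed.

Lemma cycle_edge_irrefl : irreflexive cycle_edge.
Proof. by move=> x; rewrite /cycle_edge eqxx. Qed.

Definition cycle_graph := SGraph cycle_edge_sym cycle_edge_irrefl.
End PathsAndCycles.

Lemma even_cycle_bip n :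
  exists X : {set cycle_graph (2 * n)}, bipartition X.
Proof.
exists [set x : 'I_(2 * n) | odd x]; apply/forallP => x; apply/forallP => y.
apply/implyP; rewrite /= /cycle_edge !inE => /andP[_].
have e2n : odd (2 * n) = false by rewrite oddM.
by case/orP => /eqP ->; rewrite odd_mod //=; case: odd.
Qed.

Definition even_cycle n := BipGraph (even_cycle_bip n).

(* Main.v *)
(** Both bounds follow from one for cycles. By Łuczak's method it suffices to find a large
    monochromatic connected matching in a reduced graph: a closed walk that visits all its
    edges, oscillating along each, blows up to a cycle of any prescribed even length.

    Regularity. Szemerédi's lemma is not needed. Whenever a colour has density below 1/D on a
    large subpair of a pair of clusters, delete ("kill") the colour there and refine. The
    number of killed triples (vertex, vertex, colour) bounds the number of steps, few edges are
    killed in all, and in the end almost every pair is lower-regular in some colour.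

    Connected matchings. Measure sizes in units of [n]. If there is no connected matching
    larger than [n], König's theorem covers each component of each colour by a set of size at
    most 1; call its elements centres. A vertex sends edges of weight at most 1 in every
    colour of which it is not a centre, so each vertex is a centre of some colour; it is bad if
    it is a centre of only one. With [K = k - 2] and sides [2K + 1/2 + 1/K], if every colour
    has bad vertices of size at most 1, counting edges gives a contradiction. A bad vertex has a
    component in its colour containing nearly half of the other side, and bad vertices on both
    sides in the same colour are joined in that colour. So a colour with more bad vertices has
    them on one side, in exactly two components; deleting the covers of these components and
    the rest of the other side removes the colour altogether. Deletion takes sides
    [2u + Da], [2u + Db], where [u + 2] is the number of colours, essentially to
    [2(u-1) + Da], [2(u-1) + 2 Db], and it is impossible once [Db > 2]. Hence it happens at
    most three times per side, and [k >= 8] leaves enough colours for the edge count. *)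

Require Import Defs.
From HB Require Import structures.
From mathcomp Require Import all_boot zify.

Set Implicit Arguments.
Unset Strict Implicit.
Unset Printing Implicit Defensive.

(** * Matchings and vertex covers in finite bipartite graphs *)

Lemma subset_of_card (X : finType) (A : {set X}) t : t <= #|A| ->
  exists2 A' : {set X}, A' \subset A & #|A'| = t.
Proof.
move=> h; exists [set x in take t (enum A)].
  by apply/subsetP => x; rewrite inE => /mem_take; rewrite mem_enum.
by rewrite cardsE (card_uniqP _) ?take_uniq ?enum_uniq // size_takel // -cardE.
Qed.

Definition matching (X Y : finType) (M : {set X * Y}) :=
  {in M &, injective fst} /\ {in M &, injective snd}.

Definition covers (X Y : finType) (E : {set X * Y}) (S : {set X}) (T : {set Y}) :=
  forall p, p \in E -> (p.1 \in S) || (p.2 \in T).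

(* If two edges of [E] share an end, minimum covers of [E] minus either edge
   combine, in the lattice of covers, into two covers of [E] of total size at
   most one more than the sum; so one of them is small enough. *)
Theorem konig (X Y : finType) (E : {set X * Y}) :
  exists S T (M : {set X * Y}),
    [/\ M \subset E, matching M, covers E S T & #|S| + #|T| <= #|M|].
Proof.
have [N] := ubnP #|E|; elim: N => // N IH in E *; rewrite ltnS => leE.
set goal := ex _.
(* Induction gives a small cover of [E] minus [e]. Either it covers [e] as well and the goal holds,
   or it misses both ends of [e]. *)
have rec e : e \in E -> goal \/
  exists S T (M : {set X * Y}),
    [/\ M \subset E /\ matching M, covers (E :\ e) S T,
        (e.1 \notin S) && (e.2 \notin T) & #|S| + #|T| <= #|M|].
  move=> eE; have [|S [T [M [sM mM cov le]]]] := IH (E :\ e).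
    by move: leE; rewrite (cardsD1 e) eE.
  have sME := subset_trans sM (subsetDl _ _).
  case: (boolP ((e.1 \in S) || (e.2 \in T))) => ec; last first.
    by right; exists S, T, M; rewrite -negb_or.
  left; exists S, T, M; split=> // p pE.
  by have [->//|ne] := eqVneq p e; apply: cov; rewrite !inE ne.
have finish (S1 : {set X}) (T1 : {set Y}) (M1 : {set X * Y})
    (S2 : {set X}) (T2 : {set Y}) (M2 : {set X * Y})
    (S3 : {set X}) (T3 : {set Y}) (S4 : {set X}) (T4 : {set Y}) :
   M1 \subset E /\ matching M1 -> M2 \subset E /\ matching M2 ->
   #|S1| + #|T1| <= #|M1| -> #|S2| + #|T2| <= #|M2| ->
   #|S3| + #|T3| + (#|S4| + #|T4|) <= (#|S1| + #|T1| + #|S2| + #|T2|).+1 ->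
   covers E S3 T3 -> covers E S4 T4 -> goal.
  move=> h1 h2 l1 l2 l3 c3 c4.
  have [M [[sM mM] eM]] : exists M : {set X * Y}, (M \subset E /\ matching M) /\
      #|M| = maxn #|M1| #|M2|.
    by case: (leqP #|M2| #|M1|) => h; [exists M1 | exists M2]; split=> //; lia.
  have [le|le] : #|S3| + #|T3| <= #|M| \/ #|S4| + #|T4| <= #|M| by lia.
    by exists S3, T3, M.
  by exists S4, T4, M.
have [/existsP[e /existsP[f]]|/existsPn nX] :=
    boolP [exists e, exists f, [&& e \in E, f \in E, e != f & e.1 == f.1]].
  case/and4P=> eE fE ef /eqP e1.
  case: (rec e eE) => // -[S1 [T1 [M1 [s1 c1 /andP[eS1 eT1] l1]]]].
  case: (rec f fE) => // -[S2 [T2 [M2 [s2 c2 /andP[fS2 fT2] l2]]]].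
  apply: (finish S1 T1 M1 S2 T2 M2 (e.1 |: (S1 :|: S2)) (T1 :&: T2)
    (S1 :&: S2) (T1 :|: T2)) => //.
  - have := cardsUI S1 S2; have := cardsUI T1 T2; rewrite cardsU1.
    by case: (_ \notin _) => /=; clear; lia.
  - move=> p pE; rewrite !inE; have := c1 p; have := c2 p; rewrite !inE pE !andbT.
    have [->|ne] := eqVneq p e; first by rewrite eqxx.
    have [->|nf] := eqVneq p f; first by rewrite e1 eqxx.
    move=> /(_ isT) + /(_ isT).
    by case: (_ \in S1); case: (_ \in S2); case: (_ \in T1); case: (_ \in T2); rewrite ?orbT.
  (* The edge [e] lies in [E] minus [f] and its left end is that of [f], which [S2] misses; so [T2]
     contains its right end. Likewise for [f] and [T1]. *)
  - move=> p pE; rewrite !inE; have := c1 p; have := c2 p; rewrite !inE pE !andbT.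
    have [->|ne] := eqVneq p e.
      by rewrite ef e1 (negPf fS2) /= => /(_ isT)-> _; rewrite !orbT.
    have [->|nf] := eqVneq p f.
      by rewrite -e1 (negPf eS1) /= => _ /(_ isT) ->.
    move=> /(_ isT) + /(_ isT).
    by case: (_ \in S1); case: (_ \in S2); case: (_ \in T1); case: (_ \in T2); rewrite ?orbT.
have [/existsP[e /existsP[f]]|/existsPn nY] :=
    boolP [exists e, exists f, [&& e \in E, f \in E, e != f & e.2 == f.2]].
  case/and4P=> eE fE ef /eqP e1.
  case: (rec e eE) => // -[S1 [T1 [M1 [s1 c1 /andP[eS1 eT1] l1]]]].
  case: (rec f fE) => // -[S2 [T2 [M2 [s2 c2 /andP[fS2 fT2] l2]]]].
  apply: (finish S1 T1 M1 S2 T2 M2 (S1 :&: S2) (e.2 |: (T1 :|: T2))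
    (S1 :|: S2) (T1 :&: T2)) => //.
  - have := cardsUI S1 S2; have := cardsUI T1 T2; rewrite cardsU1.
    by case: (_ \notin _) => /=; clear; lia.
  - move=> p pE; rewrite !inE; have := c1 p; have := c2 p; rewrite !inE pE !andbT.
    have [->|ne] := eqVneq p e; first by rewrite eqxx orbT.
    have [->|nf] := eqVneq p f; first by rewrite e1 eqxx orbT.
    move=> /(_ isT) + /(_ isT).
    by case: (_ \in S1); case: (_ \in S2); case: (_ \in T1); case: (_ \in T2); rewrite ?orbT.
  - move=> p pE; rewrite !inE; have := c1 p; have := c2 p; rewrite !inE pE !andbT.
    have [->|ne] := eqVneq p e.
      by rewrite ef e1 (negPf fT2) orbF /= => /(_ isT)-> _; rewrite !orbT.
    have [->|nf] := eqVneq p f.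
      by rewrite -e1 (negPf eT1) orbF /= => _ /(_ isT) ->.
    move=> /(_ isT) + /(_ isT).
    by case: (_ \in S1); case: (_ \in S2); case: (_ \in T1); case: (_ \in T2); rewrite ?orbT.
exists [set p.1 | p in E], set0, E; split=> //; first split.
- move=> e f eE fE h; apply/eqP; apply: contraT => ne.
  by move/existsPn: (nX e) => /(_ f); rewrite eE fE ne h eqxx.
- move=> e f eE fE h; apply/eqP; apply: contraT => ne.
  by move/existsPn: (nY e) => /(_ f); rewrite eE fE ne h eqxx.
- by move=> p pE; rewrite imset_f.
- by rewrite cards0 addn0 leq_imset_card.
Qed.

(** * A regularity lemma for lower-regular pairs *)

Lemma card_bigcup_disjoint (I T : finType) (K : {set I}) (F : I -> {set T}) :
  {in K &, forall i j, i != j -> [disjoint F i & F j]} ->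
  #|\bigcup_(i in K) F i| = \sum_(i in K) #|F i|.
Proof.
move=> dF; rewrite big_mkcond -sum1_card partition_disjoint_bigcup /=.
  by rewrite [RHS]big_mkcond; apply: eq_bigr => i _; rewrite sum1_card; case: ifP; rewrite ?cards0.
by move=> i j ne; case: ifP => iK; case: ifP => jK; rewrite ?dF // -setI_eq0 ?set0I ?setI0.
Qed.

Lemma card_cover_const (T : finType) (P : {set {set T}}) m : trivIset P ->
  {in P, forall A : {set _}, #|A| = m} -> #|cover P| = #|P| * m.
Proof.
by move=> /eqP<- cP; rewrite -sum_nat_const; apply: eq_bigr => A /cP.
Qed.

(** Take a maximal disjoint family of [m]-subsets of [U] on which [f] is constant: if more than [m]
    points of a fibre were left over, another set could be added. *)
Lemma chop (T L : finType) (U : {set T}) (f : T -> L) m : 0 < m ->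
  exists P : {set {set T}},
    [/\ trivIset P, {in P, forall A : {set _}, #|A| = m}, {in P, forall A : {set _}, A \subset U},
        {in P, forall A : {set _}, {in A &, forall x y, f x = f y}}
      & #|U :\: cover P| <= #|f @: U| * m].
Proof.
move=> m0.
pose good (P : {set {set T}}) := trivIset P && [forall A in P, [&& #|A| == m, A \subset U &
  [forall x in A, forall y in A, f x == f y]]].
have [P /maxsetP[/andP[tP /forall_inP gP] maxP]] : {P | maxset good P}.
  apply: ex_maxset; exists set0; apply/andP; split; last by apply/forall_inP => A; rewrite inE.
  by rewrite /trivIset /cover !big_set0 cards0.
have hP A : A \in P -> [/\ #|A| = m, A \subset U & {in A &, forall x y, f x = f y}].
  by case/gP/and3P=> /eqP ? ? /forall_inP h; split=> // x y /h/forall_inP hx /hx/eqP.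
exists P; split=> //; try by move=> A /hP[].
have small l : #|[set x in U :\: cover P | f x == l]| <= m.
  rewrite leqNgt; apply/negP => /ltnW big.
  have [A sA cA] := subset_of_card big.
  have dA : {in P, forall B : {set T}, [disjoint A & B]}.
    move=> B BP; rewrite disjoint_subset; apply/subsetP => x /(subsetP sA).
    rewrite !inE => /andP[/andP[xP _] _]; apply: contraNN xP => xB.
    by apply/bigcupP; exists B.
  have P0 : set0 \notin P.
    by apply/negP => /hP[]; rewrite cards0 => e; rewrite -e in m0.
  have [tAP AP] := trivIsetU1 dA tP P0.
  have gAP : good (A |: P).
    apply/andP; split=> //; apply/forall_inP => B; rewrite inE => /orP[/set1P->|/gP//].
    rewrite cA eqxx (subset_trans sA) /=; last first.
      by apply/subsetP => x; rewrite !inE => /andP[/andP[_ ->]].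
    apply/forall_inP => x /(subsetP sA) hx; apply/forall_inP => y /(subsetP sA).
    by move: hx; rewrite !inE => /andP[_ /eqP->] /andP[_ /eqP->].
  by have := maxP _ gAP (subsetUr _ _) => e; rewrite -e setU11 in AP.
rewrite -sum1_card (partition_big f (mem (f @: U))) /=; last first.
  by move=> x; rewrite inE => /andP[_ xU]; apply: imset_f.
rewrite -sum_nat_const; apply: leq_sum => l _; apply: leq_trans (small l).
by rewrite -sum1dep_card; apply: leq_sum => x; rewrite !inE.
Qed.

Section Pairs.
Variables (X Y : finType) (k q D : nat) (col : X -> Y -> 'I_k).

Definition colour_pairs i (A : {set X}) (B : {set Y}) :=
  [set p in setX A B | col p.1 p.2 == i].

(** One-sided regularity: density at least [1/D] between subsets that form a [1/q] fraction of their
    sides, which suffices for greedy embedding. *)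
Definition lower_regular i (A : {set X}) (B : {set Y}) :=
  [forall A' : {set X}, forall B' : {set Y},
    [&& A' \subset A, B' \subset B, #|A| <= q * #|A'| & #|B| <= q * #|B'|] ==>
    (#|A'| * #|B'| <= D * #|colour_pairs i A' B'|)].

Definition irregular (P : {set {set X}}) (P' : {set {set Y}}) :=
  [set p in setX P P' | [forall i, ~~ lower_regular i p.1 p.2]].

(* [Z i] is the set of pairs on which colour [i] has been killed. *)
Record system (P : {set {set X}}) (P' : {set {set Y}}) m (Z : 'I_k -> {set X * Y}) : Prop :=
  System {
    sys_trivl : trivIset P;
    sys_trivr : trivIset P';
    sys_cardl : {in P, forall A : {set _}, #|A| = m};
    sys_cardr : {in P', forall B : {set _}, #|B| = m};
    sys_compat : forall A B i, A \in P -> B \in P' ->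
      (setX A B \subset Z i) || [disjoint setX A B & Z i];
    sys_sparse : D * \sum_i #|[set p in Z i | col p.1 p.2 == i]| <= \sum_i #|Z i| }.

Lemma setX_disjoint (A A' : {set X}) (B B' : {set Y}) :
  [disjoint A & A'] \/ [disjoint B & B'] -> [disjoint setX A B & setX A' B'].
Proof.
move=> h; rewrite -setI_eq0; apply/eqP/setP => -[x y]; rewrite !inE /=.
apply/negP => /andP[/andP[xA yB] /andP[xA' yB']]; case: h => d.
  by rewrite (disjointFr d xA) in xA'.
by rewrite (disjointFr d yB) in yB'.
Qed.

Lemma pairs_disjoint (P : {set {set X}}) (P' : {set {set Y}}) p p' :
  trivIset P -> trivIset P' -> p \in setX P P' -> p' \in setX P P' -> p != p' ->
  [disjoint setX p.1 p.2 & setX p'.1 p'.2].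
Proof.
move=> /trivIsetP t1 /trivIsetP t2; rewrite !inE => /andP[h1 h2] /andP[h3 h4] ne.
apply: setX_disjoint; have [e1|n1] := eqVneq p.1 p'.1; last by left; apply: t1.
right; apply: t2 => //; apply: contraNneq ne => e2.
by rewrite -pair_eqE /pair_eq e1 e2 !eqxx.
Qed.

Lemma irregular_hole i (A : {set X}) (B : {set Y}) : ~~ lower_regular i A B ->
  exists H : {set X} * {set Y}, [/\ H.1 \subset A, H.2 \subset B,
    #|A| <= q * #|H.1|, #|B| <= q * #|H.2|
    & D * #|colour_pairs i H.1 H.2| <= #|H.1| * #|H.2|].
Proof.
case/forallPn => A' /forallPn[B']; rewrite negb_imply -ltnNge.
by case/andP=> /and4P[h1 h2 h3 h4] /ltnW h5; exists (A', B').
Qed.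

(* Pairs in which every colour is killed lose all their edges, hence are rare. *)
Lemma dead_pairs (P : {set {set X}}) (P' : {set {set Y}}) m Z
    (K : {set {set X} * {set Y}}) : system P P' m Z ->
  K \subset setX P P' ->
  (forall p, p \in K -> forall i, setX p.1 p.2 \subset Z i) ->
  D * (#|K| * (m * m)) <= \sum_i #|Z i|.
Proof.
move=> sys /subsetP sK hK; apply: leq_trans (sys_sparse sys); rewrite leq_mul2l; apply/orP; right.
have -> : #|K| * (m * m) = #|\bigcup_(p in K) setX p.1 p.2|.
  rewrite card_bigcup_disjoint => [|p p' /sK pK /sK p'K]; last first.
    exact: pairs_disjoint (sys_trivl sys) (sys_trivr sys) pK p'K.
  rewrite -sum_nat_const; apply: eq_bigr => p /sK; rewrite inE => /andP[h1 h2].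
  by rewrite cardsX (sys_cardl sys) // (sys_cardr sys).
have -> : \sum_i #|[set p in Z i | col p.1 p.2 == i]| =
    #|[set p | p \in Z (col p.1 p.2)]|.
  rewrite -[RHS]sum1_card (partition_big (fun p => col p.1 p.2) xpredT) //=.
  apply: eq_bigr => i _; rewrite -sum1_card; apply: eq_bigl => p; rewrite !inE.
  by case: eqP => [->|]; rewrite ?andbF.
apply: subset_leq_card; apply/subsetP => z /bigcupP[p pK zp]; rewrite inE.
exact: subsetP (hK p pK _) z zp.
Qed.

Section Kill.
Variables (P : {set {set X}}) (P' : {set {set Y}}) (m : nat) (Z : 'I_k -> {set X * Y}).
Hypothesis sys : system P P' m Z.
Variable K : {set {set X} * {set Y}}.
Variables (H1 : {set X} * {set Y} -> {set X}) (H2 : {set X} * {set Y} -> {set Y}).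
Variable hc : {set X} * {set Y} -> 'I_k.
Hypothesis sK : K \subset setX P P'.
Hypothesis alive : forall p, p \in K -> ~~ (setX p.1 p.2 \subset Z (hc p)).
Hypothesis sH1 : forall p, p \in K -> H1 p \subset p.1.
Hypothesis sH2 : forall p, p \in K -> H2 p \subset p.2.
Hypothesis sparse : forall p, p \in K ->
  D * #|colour_pairs (hc p) (H1 p) (H2 p)| <= #|H1 p| * #|H2 p|.

Let KP p : p \in K -> p.1 \in P /\ p.2 \in P'.
Proof. by move/(subsetP sK); rewrite inE => /andP[]. Qed.

Definition killed i := \bigcup_(p in K | hc p == i) setX (H1 p) (H2 p).
Definition Zk i := Z i :|: killed i.

Let sHX p : p \in K -> setX (H1 p) (H2 p) \subset setX p.1 p.2.
Proof. by move=> pK; apply: setXS; rewrite ?sH1 ?sH2. Qed.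

Lemma card_killed i : #|killed i| = \sum_(p in K | hc p == i) #|H1 p| * #|H2 p|.
Proof.
rewrite /killed (eq_bigl (mem [set p in K | hc p == i])); last by move=> p; rewrite !inE.
rewrite card_bigcup_disjoint.
  by apply: eq_big => [p|p _]; rewrite ?inE // cardsX.
move=> p p'; rewrite !inE => /andP[pK _] /andP[p'K _] ne.
apply: disjointWl (sHX pK) _; apply: disjointWr (sHX p'K) _.
by apply: (@pairs_disjoint P P') ne; rewrite ?(sys_trivl sys) ?(sys_trivr sys) ?(subsetP sK).
Qed.

(** The holes are new: a block pair not inside [Z i] is disjoint from it by compatibility, so the
    killed areas add up. *)
Lemma card_Zk i : #|Zk i| = #|Z i| + \sum_(p in K | hc p == i) #|H1 p| * #|H2 p|.
Proof.
rewrite -card_killed cardsU (_ : Z i :&: killed i = set0) ?cards0 ?subn0 //.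
apply/eqP; rewrite setI_eq0; apply/bigcup_disjointP => p /andP[pK /eqP hp].
have [h1 h2] := KP pK; have := sys_compat sys i h1 h2.
rewrite -hp (negPf (alive pK)) /= disjoint_sym.
exact: disjointWr (sHX pK).
Qed.

Lemma sum_Zk : \sum_i #|Zk i| = \sum_i #|Z i| + \sum_(p in K) #|H1 p| * #|H2 p|.
Proof.
rewrite (eq_bigr _ (fun i _ => card_Zk i)) big_split /=; congr (_ + _).
by rewrite (partition_big hc xpredT).
Qed.

Lemma sparse_Zk : D * \sum_i #|[set p in Zk i | col p.1 p.2 == i]| <= \sum_i #|Zk i|.
Proof.
have sp : \sum_(p in K) D * #|colour_pairs (hc p) (H1 p) (H2 p)| <=
  \sum_(p in K) #|H1 p| * #|H2 p| by apply: leq_sum => p; apply: sparse.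
rewrite sum_Zk; apply: leq_trans (leq_add (sys_sparse sys) sp).
rewrite -big_distrr -mulnDr leq_mul2l; apply/orP; right.
rewrite (partition_big hc xpredT (P := fun p => p \in K)) //= -big_split /=.
apply: leq_sum => i _.
have -> : [set p in Zk i | col p.1 p.2 == i] = [set p in Z i | col p.1 p.2 == i] :|:
   \bigcup_(p in K | hc p == i) colour_pairs (hc p) (H1 p) (H2 p).
  apply/setP => z; rewrite !inE andb_orl; congr (_ || _).
  apply/andP/bigcupP => [[/bigcupP[p pK zp] e]|[p /andP[pK /eqP hp]]].
    by exists p => //; rewrite inE zp; case/andP: pK => _ /eqP->.
  by rewrite inE hp => /andP[zp e]; split=> //; apply/bigcupP; exists p; rewrite // pK hp eqxx.
apply: leq_trans (leq_card_setU _ _) _; rewrite leq_add2l.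
elim/big_rec2: _ => [|p n B _ le]; first by rewrite cards0.
by apply: leq_trans (leq_card_setU _ _) _; rewrite leq_add2l.
Qed.

(** The signature of a point records its block and the holes it lies in, so a set of constant
    signature is inside or outside each hole. *)
Definition sigl x := (pblock P x, [set B in P' | x \in H1 (pblock P x, B)]).
Definition sigr y := (pblock P' y, [set A in P | y \in H2 (A, pblock P' y)]).

Lemma card_sigl : #|sigl @: cover P| <= #|P| * 2 ^ #|P'|.
Proof.
rewrite -card_powerset -cardsX; apply: subset_leq_card; apply/subsetP => s /imsetP[x xP ->].
by rewrite !inE pblock_mem //=; apply/subsetP => B; rewrite inE => /andP[].
Qed.

Lemma card_sigr : #|sigr @: cover P'| <= #|P'| * 2 ^ #|P|.
Proof.
rewrite -card_powerset -cardsX; apply: subset_leq_card; apply/subsetP => s /imsetP[x xP ->].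
by rewrite !inE pblock_mem //=; apply/subsetP => B; rewrite inE => /andP[].
Qed.

(** A new pair lies in one old pair, and its points agree on membership in the hole there; so in
    each colour it is wholly killed or untouched. *)
Lemma refine_system m' (Q : {set {set X}}) (Q' : {set {set Y}}) : 0 < m' ->
  trivIset Q -> {in Q, forall A : {set _}, #|A| = m'} ->
  {in Q, forall A : {set _}, A \subset cover P} ->
  {in Q, forall A : {set _}, {in A &, forall x y, sigl x = sigl y}} ->
  trivIset Q' -> {in Q', forall A : {set _}, #|A| = m'} ->
  {in Q', forall A : {set _}, A \subset cover P'} ->
  {in Q', forall A : {set _}, {in A &, forall x y, sigr x = sigr y}} ->
  system Q Q' m' Zk.
Proof.
move=> m0 tQ cQ sQ gQ tQ' cQ' sQ' gQ'; split=> //; last exact: sparse_Zk.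
move=> A1 B1 i A1Q B1Q.
have [x0 x0A] : exists x, x \in A1 by apply/card_gt0P; rewrite cQ.
have [y0 y0B] : exists y, y \in B1 by apply/card_gt0P; rewrite cQ'.
have x0P := subsetP (sQ _ A1Q) x0 x0A; have y0P := subsetP (sQ' _ B1Q) y0 y0B.
pose A := pblock P x0; pose B := pblock P' y0.
have AP : A \in P by apply: pblock_mem.
have BP : B \in P' by apply: pblock_mem.
have sA : A1 \subset A.
  apply/subsetP => x xA; have := gQ _ A1Q _ _ xA x0A => -[e _].
  by rewrite /A -e mem_pblock (subsetP (sQ _ A1Q)).
have sB : B1 \subset B.
  apply/subsetP => y yB; have := gQ' _ B1Q _ _ yB y0B => -[e _].
  by rewrite /B -e mem_pblock (subsetP (sQ' _ B1Q)).
have sX := setXS sA sB.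
case/orP: (sys_compat sys i AP BP) => h.
  by rewrite (subset_trans (subset_trans sX h) (subsetUl _ _)).
have inH x y p : x \in A1 -> y \in B1 -> p \in K -> (x, y) \in setX p.1 p.2 -> p = (A, B).
  move=> xA yB /KP[p1 p2]; rewrite inE /= => /andP[xp yp].
  rewrite (surjective_pairing p) -(def_pblock (sys_trivl sys) p1 xp).
  rewrite -(def_pblock (sys_trivr sys) p2 yp).
  by rewrite (def_pblock (sys_trivl sys) AP (subsetP sA _ xA))
     (def_pblock (sys_trivr sys) BP (subsetP sB _ yB)).
have [hK|nK] := boolP ((A, B) \in K).
  have eH1 x : x \in A1 -> (x \in H1 (A, B)) = (x0 \in H1 (A, B)).
    move=> xA; have := gQ _ A1Q _ _ xA x0A => -[e] /setP/(_ B); rewrite !inE BP /=.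
    by rewrite e.
  have eH2 y : y \in B1 -> (y \in H2 (A, B)) = (y0 \in H2 (A, B)).
    move=> yB; have := gQ' _ B1Q _ _ yB y0B => -[e] /setP/(_ A); rewrite !inE AP /=.
    by rewrite e.
  have [/and3P[hi hx hy]|no] := boolP [&& hc (A, B) == i, x0 \in H1 (A, B) & y0 \in H2 (A, B)].
    apply/orP; left; apply/subsetP => -[x y]; rewrite inE /= => /andP[xA yB].
    rewrite inE; apply/orP; right; apply/bigcupP; exists (A, B); first by rewrite hK.
    by rewrite inE /= eH1 // eH2 // hx.
  apply/orP; right; rewrite disjoint_sym disjoint_subset; apply/subsetP => -[x y].
  rewrite inE => hZ; rewrite inE; apply/negP; rewrite inE /= => /andP[xA yB].
  case/orP: hZ => [hZ|/bigcupP[p /andP[pK hp] hxy]].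
    have := disjointFl h hZ; rewrite inE /=.
    by rewrite (subsetP sA) // (subsetP sB).
  have ep := inH _ _ _ xA yB pK (subsetP (sHX pK) _ hxy); rewrite ep in hp hxy.
  by case/negP: no; move: hxy; rewrite inE /= eH1 // eH2 // hp.
apply/orP; right; rewrite disjoint_sym disjoint_subset; apply/subsetP => -[x y].
rewrite inE => hZ; rewrite inE; apply/negP; rewrite inE /= => /andP[xA yB].
case/orP: hZ => [hZ|/bigcupP[p /andP[pK hp] hxy]].
  have := disjointFl h hZ; rewrite inE /=.
  by rewrite (subsetP sA) // (subsetP sB).
have ep := inH _ _ _ xA yB pK (subsetP (sHX pK) _ hxy).
by rewrite -ep pK in nK.
Qed.

End Kill.
End Pairs.

Section Step.
Variables (k q D G : nat).
Hypotheses (G2 : 2 <= G) (hD : 8 * k * G <= D).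

Section Fixed.
Variables (X Y : finType) (N : nat) (col : X -> Y -> 'I_k).
Hypotheses (cX : #|X| = N) (cY : #|Y| = N) (N0 : 0 < N).

Lemma potential_le (Z : 'I_k -> {set X * Y}) : \sum_i #|Z i| <= k * (N * N).
Proof.
have -> : k * (N * N) = \sum_(i < k) N * N by rewrite sum_nat_const card_ord.
by apply: leq_sum => i _; rewrite -{1}cX -cY -card_prod max_card.
Qed.

(** An energy increment, the energy being the number of killed triples. By [dead_pairs] at most half
    of the irregular pairs have all colours killed; each of the others has a hole still to be
    killed, of area at least [m^2/q^2]. The total gain is at least [N^2/(8 G q^2)]. *)
Lemma regularity_step (P : {set {set X}}) (P' : {set {set Y}}) m Z m' C :
  system D col P P' m Z -> 0 < m' -> N <= C * m ->
  2 * #|~: cover P| <= N -> 2 * #|~: cover P'| <= N ->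
  #|P| * #|P'| < #|irregular q D col P P'| * G ->
  exists (Q : {set {set X}}) (Q' : {set {set Y}}) (Z' : 'I_k -> {set X * Y}),
   [/\ system D col Q Q' m' Z',
       #|~: cover Q| <= #|~: cover P| + C * 2 ^ C * m',
       #|~: cover Q'| <= #|~: cover P'| + C * 2 ^ C * m'
     & (\sum_i #|Z i|) * (8 * G * q ^ 2) + N * N <= (\sum_i #|Z' i|) * (8 * G * q ^ 2)].
Proof.
move=> sys m'0 NC uP uP' irr.
have m0 : 0 < m by case: (m) NC => //; rewrite muln0; lia.
have [x0 _] : exists x0 : X, x0 \in X by apply/card_gt0P; rewrite cX.
have [y0 _] : exists y0 : Y, y0 \in Y by apply/card_gt0P; rewrite cY.
have k0 : 0 < k by case: (k) (col x0 y0) => // -[].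
have cP : #|cover P| = #|P| * m := card_cover_const (sys_trivl sys) (sys_cardl sys).
have cP' : #|cover P'| = #|P'| * m := card_cover_const (sys_trivr sys) (sys_cardr sys).
have eP := cardsC (cover P); have eP' := cardsC (cover P').
rewrite cP cX in eP; rewrite cP' cY in eP'.
have leP : #|P| <= C by rewrite -(leq_pmul2r m0); lia.
have leP' : #|P'| <= C by rewrite -(leq_pmul2r m0); lia.
pose K := [set p in irregular q D col P P' | [exists i, ~~ (setX p.1 p.2 \subset Z i)]].
have [H hH] : exists H : {set X} * {set Y} -> {set X} * {set Y} * 'I_k,
  forall p, p \in K -> [/\ ~~ (setX p.1 p.2 \subset Z (H p).2),
    (H p).1.1 \subset p.1 /\ (H p).1.2 \subset p.2,
    #|p.1| <= q * #|(H p).1.1|, #|p.2| <= q * #|(H p).1.2| &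
    D * #|colour_pairs col (H p).2 (H p).1.1 (H p).1.2| <= #|(H p).1.1| * #|(H p).1.2| ].
  apply: (@fin_all_exists _ (fun _ => ({set X} * {set Y} * 'I_k)%type)
    (fun p H => p \in K -> [/\ ~~ (setX p.1 p.2 \subset Z H.2),
    H.1.1 \subset p.1 /\ H.1.2 \subset p.2,
    #|p.1| <= q * #|H.1.1|, #|p.2| <= q * #|H.1.2| &
    D * #|colour_pairs col H.2 H.1.1 H.1.2| <= #|H.1.1| * #|H.1.2| ])) => p.
  case: (boolP (p \in K)) => [pK|_]; last by exists (set0, set0, col x0 y0).
  move: pK; rewrite !inE => /andP[/andP[_ /forallP irrp] /existsP[i hi]].
  have [[A B] /= [h1 h2 h3 h4 h5]] := irregular_hole (irrp i).
  by exists (A, B, i).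
have sK : K \subset setX P P'.
  by apply/subsetP => p; rewrite !inE => /andP[/andP[]].
pose H1 p := (H p).1.1; pose H2 p := (H p).1.2; pose hc p := (H p).2.
have alive p : p \in K -> ~~ (setX p.1 p.2 \subset Z (hc p)) by case/hH.
have sH1 p : p \in K -> H1 p \subset p.1 by case/hH => _ [].
have sH2 p : p \in K -> H2 p \subset p.2 by case/hH => _ [].
have sparse p : p \in K -> D * #|colour_pairs col (hc p) (H1 p) (H2 p)| <= #|H1 p| * #|H2 p|.
  by case/hH.
have [Q [tQ cQ sQ gQ uQ]] := chop (cover P) (sigl P P' H1) m'0.
have [Q' [tQ' cQ' sQ' gQ' uQ']] := chop (cover P') (sigr P P' H2) m'0.
have sysQ := refine_system sys sK alive sH1 sH2 sparse m'0 tQ cQ sQ gQ tQ' cQ' sQ' gQ'.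
exists Q, Q', (Zk Z K H1 H2 hc); split=> //.
- apply: (@leq_trans (#|~: cover P :|: cover P :\: cover Q|)).
    apply: subset_leq_card; apply/subsetP => x; rewrite !inE => ->.
    by case: (x \in cover P).
  apply: leq_trans (leq_card_setU _ _) _; rewrite leq_add2l.
  apply: leq_trans uQ _; rewrite leq_pmul2r //.
  apply: leq_trans (card_sigl _ _ _) _; apply: leq_mul => //.
  by rewrite leq_exp2l.
- apply: (@leq_trans (#|~: cover P' :|: cover P' :\: cover Q'|)).
    apply: subset_leq_card; apply/subsetP => x; rewrite !inE => ->.
    by case: (x \in cover P').
  apply: leq_trans (leq_card_setU _ _) _; rewrite leq_add2l.
  apply: leq_trans uQ' _; rewrite leq_pmul2r //.
  apply: leq_trans (card_sigr _ _ _) _; apply: leq_mul => //.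
  by rewrite leq_exp2l.
rewrite (sum_Zk sys sK alive sH1 sH2) mulnDl leq_add2l.
pose FK := irregular q D col P P' :\: K.
have cirr : #|irregular q D col P P'| = #|K| + #|FK|.
  rewrite -(cardsID K (irregular _ _ _ _ _)) (_ : _ :&: K = K) //.
  by apply/setIidPr/subsetP => p; rewrite inE => /andP[].
have hFK : D * (#|FK| * (m * m)) <= k * (N * N).
  apply: leq_trans (potential_le Z); apply: (dead_pairs sys).
    by apply/subsetP => p; rewrite !inE => /andP[_ /andP[]].
  move=> p; rewrite inE => /andP[pK pirr] i.
  by apply: contraNT pK => h; rewrite inE pirr; apply/existsP; exists i.
have gain : #|K| * (m * m) <= q ^ 2 * \sum_(p in K) #|H1 p| * #|H2 p|.
  rewrite big_distrr /= -sum_nat_const; apply: leq_sum => p pK.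
  have [_ _ h1 h2 _] := hH p pK.
  have /setXP[pP pP'] : (p.1, p.2) \in setX P P' by rewrite -surjective_pairing (subsetP sK).
  rewrite (sys_cardl sys) // in h1; rewrite (sys_cardr sys) // in h2.
  by rewrite /H1 /H2 -mulnn mulnACA; apply: leq_mul.
have sq : N * N <= 4 * (#|P| * #|P'| * (m * m)).
  have : N * N <= (2 * (#|P| * m)) * (2 * (#|P'| * m)) by apply: leq_mul; lia.
  by lia.
have big : N * N * 2 <= 8 * (#|irregular q D col P P'| * G * (m * m)).
  have : #|P| * #|P'| * (m * m) <= #|irregular q D col P P'| * G * (m * m).
    by apply: leq_mul => //; apply: ltnW.
  by lia.
have hFK2 : 8 * G * (#|FK| * (m * m)) <= N * N.
  rewrite -(leq_pmul2l k0); apply: leq_trans hFK.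
  by rewrite mulnA; apply: leq_mul => //; lia.
rewrite cirr in big.
have : 8 * G * (#|K| * (m * m)) <= (\sum_(p in K) #|H1 p| * #|H2 p|) * (8 * G * q ^ 2).
  have -> : (\sum_(p in K) #|H1 p| * #|H2 p|) * (8 * G * q ^ 2) =
    8 * G * (q ^ 2 * \sum_(p in K) #|H1 p| * #|H2 p|) by lia.
  by rewrite leq_pmul2l //; lia.
apply: leq_trans; rewrite !mulnDl mulnDr in big.
by move: (#|K| * G * (m * m)) (#|FK| * G * (m * m)) => *; lia.
Qed.

End Fixed.

Definition regular_partition (X Y : finType) (col : X -> Y -> 'I_k) N C0 C :=
  exists (P : {set {set X}}) (P' : {set {set Y}}) m,
    [/\ trivIset P /\ trivIset P', {in P, forall A : {set X}, #|A| = m} /\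
          {in P', forall B : {set Y}, #|B| = m},
        N <= C * m /\ C0 * m <= N, #|~: cover P| * G <= N /\ #|~: cover P'| * G <= N
      & #|irregular q D col P P'| * G <= #|P| * #|P'|].

Let F := 8 * G * q ^ 2.
(** A step gains [N^2/F] and the total is at most [k N^2], so at most [k F] steps occur; each may
    leave [N/(G R)] more points of a side uncovered. *)
Let R := (k * F).+2.

(** Induction on the number [s] of steps still allowed. The hypotheses keep the uncovered parts
    within budget and record the gain so far; with [s = 0] the killed total would exceed [k N^2]. *)
Lemma regularity_iterate C0 s C : 0 < C0 -> C0 <= C -> exists C' N0, C <= C' /\
  forall N (X Y : finType) (col : X -> Y -> 'I_k), N0 <= N -> 0 < N -> #|X| = N -> #|Y| = N ->
  forall (P : {set {set X}}) (P' : {set {set Y}}) m Z, system D col P P' m Z ->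
  N <= C * m -> C0 * m <= N ->
  #|~: cover P| * (G * R) + s * N <= R * N -> #|~: cover P'| * (G * R) + s * N <= R * N ->
  (k * F).+1 * (N * N) <= (\sum_i #|Z i|) * F + s * (N * N) ->
  regular_partition col N C0 C'.
Proof.
move=> C00; elim: s C => [|s IH] C leC.
  exists C, 0; split=> // N X Y col _ N0 cX cY P P' m Z sys _ _ _ _.
  have := potential_le cX cY Z; rewrite mul0n addn0 => h1 h2; exfalso.
  have : (\sum_i #|Z i|) * F <= k * (N * N) * F by rewrite leq_mul2r h1 orbT.
  have : 0 < N * N by rewrite muln_gt0 N0.
  by lia.
(* A refinement leaves at most [C 2^C m'] more points uncovered; with [m'] about [N/C2] this is at
   most [N/(G R)]. *)
pose C2 := C * 2 ^ C * (G * R).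
have C2C : C <= C2.
  by rewrite /C2 -mulnA leq_pmulr // !muln_gt0 expn_gt0; case: (G) G2.
have [|C' [N1 [leC' hIH]]] := IH (2 * C2); first by lia.
exists C', (maxn N1 C2); split; first by lia.
move=> N X Y col; rewrite geq_max => /andP[leN1 leC2] N0 cX cY P P' m Z sys NC CN uP uP' pot.
have GR : 0 < G * R by rewrite muln_gt0; case: (G) G2.
have u1 : #|~: cover P| * G <= N.
  have : 0 < R by []; move: uP; nia.
have u2 : #|~: cover P'| * G <= N.
  have : 0 < R by []; move: uP'; nia.
have [irr|irr] := leqP (#|irregular q D col P P'| * G) (#|P| * #|P'|).
  exists P, P', m; split=> //.
  - by split; [exact: sys_trivl sys | exact: sys_trivr sys].
  - by split; [exact: sys_cardl sys | exact: sys_cardr sys].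
  - by split=> //; apply: leq_trans NC _; rewrite leq_mul2r; lia.
have C20 : 0 < C2 by lia.
pose m' := N %/ C2.
have m'0 : 0 < m' by rewrite divn_gt0.
have m'N : C2 * m' <= N by rewrite mulnC leq_trunc_div.
have Nm' : N <= 2 * C2 * m'.
  have h := ltn_ceil N C20; apply: leq_trans (ltnW h) _.
  by rewrite -/m' [leqRHS]mulnAC leq_mul2r mul2n -addnn -[m'.+1]addn1 leq_add2l m'0 orbT.
have v1 : 2 * #|~: cover P| <= N by rewrite mulnC (leq_trans _ u1) // leq_mul2l G2 orbT.
have v2 : 2 * #|~: cover P'| <= N by rewrite mulnC (leq_trans _ u2) // leq_mul2l G2 orbT.
have [Q [Q' [Z' [sysQ uQ uQ' potQ]]]] := regularity_step cX cY N0 sys m'0 NC v1 v2 irr.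
have inc : C * 2 ^ C * m' * (G * R) <= N.
  by apply: leq_trans m'N; rewrite /C2; lia.
apply: (hIH N X Y col leN1 N0 cX cY Q Q' m' Z' sysQ Nm').
- by apply: leq_trans m'N; rewrite leq_mul2r (leq_trans leC C2C) orbT.
- have : #|~: cover Q| * (G * R) <= (#|~: cover P| + C * 2 ^ C * m') * (G * R).
    by rewrite leq_mul2r uQ orbT.
  rewrite mulnDl => h1; apply: leq_trans uP; rewrite mulSn addnA leq_add2r.
  by apply: leq_trans h1 _; rewrite leq_add2l.
- have : #|~: cover Q'| * (G * R) <= (#|~: cover P'| + C * 2 ^ C * m') * (G * R).
    by rewrite leq_mul2r uQ' orbT.
  rewrite mulnDl => h1; apply: leq_trans uP'; rewrite mulSn addnA leq_add2r.
  by apply: leq_trans h1 _; rewrite leq_add2l.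
- by apply: leq_trans pot _; rewrite mulSn addnA leq_add2r.
Qed.

(** Start from arbitrary equal parts with nothing killed; [C1] makes them so small that the
    remainder fits the budget of one step. *)
Theorem weak_regularity C0 : 0 < C0 -> exists C N0, forall N (X Y : finType)
  (col : X -> Y -> 'I_k), N0 <= N -> 0 < N -> #|X| = N -> #|Y| = N ->
  regular_partition col N C0 C.
Proof.
move=> C00; pose C1 := C0 * (G * R).
have GR : 0 < G * R by rewrite muln_gt0; case: (G) G2.
have leC : C0 <= 2 * C1 by rewrite /C1; nia.
have [C [N1 [_ h]]] := @regularity_iterate C0 (k * F).+1 (2 * C1) C00 leC.
exists C, (maxn N1 C1) => N X Y col; rewrite geq_max => /andP[leN1 leC1] N0 cX cY.
pose m := N %/ C1.
have C10 : 0 < C1 by rewrite muln_gt0 C00.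
have m0 : 0 < m by rewrite divn_gt0.
have mN : C1 * m <= N by rewrite mulnC leq_trunc_div.
have Nm : N <= 2 * C1 * m by have := ltn_ceil N C10; rewrite -/m => ?; nia.
have [P [tP cP _ _ uP]] := chop [set: X] (fun=> tt) m0.
have [P' [tP' cP' _ _ uP']] := chop [set: Y] (fun=> tt) m0.
have one (T : finType) (U : {set T}) : #|(fun=> tt) @: U| <= 1.
  by rewrite -card_unit; apply: max_card.
have mGR : m * (G * R) <= N by apply: leq_trans mN; rewrite /C1; nia.
apply: (h N X Y col leN1 N0 cX cY P P' m (fun=> set0)) => //.
- split=> //; first by move=> A B i _ _; rewrite -[X in _ || X]setI_eq0 setI0 eqxx orbT.
  rewrite big1 ?muln0 // => i _; apply/eqP; rewrite cards_eq0; apply/eqP/setP => p.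
  by rewrite !inE.
- by apply: leq_trans mN; rewrite /C1; nia.
- have : #|~: cover P| <= m.
    by rewrite -setTD; apply: leq_trans uP _; rewrite -[X in _ <= X]mul1n leq_mul2r one orbT.
  by move=> le; rewrite [R * N]mulSn leq_add // (leq_trans _ mGR) // leq_mul2r le orbT.
- have : #|~: cover P'| <= m.
    by rewrite -setTD; apply: leq_trans uP' _; rewrite -[X in _ <= X]mul1n leq_mul2r one orbT.
  by move=> le; rewrite [R * N]mulSn leq_add // (leq_trans _ mGR) // leq_mul2r le orbT.
- by rewrite leq_addl.
Qed.

End Step.

(** * Cycles from walks in the reduced graph *)

Section Embedding.
Variables (V R : finType) (e : rel V) (W : R -> {set V}) (rr : rel R) (dom : {set R}).
Variables m q D h : nat.

Definition nbh v (B : {set V}) := [set y in B | e v y].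

Hypotheses (e_sym : symmetric e) (e_irr : irreflexive e).
Hypotheses (m_gt0 : 0 < m) (D_gt0 : 0 < D).
Hypotheses (qh : m * D <= q * h) (hm : 2 * D * h <= m) (qD : 2 * D <= q).
Hypothesis W_card : forall r, r \in dom -> #|W r| = m.
Hypothesis W_disj : forall r r', r \in dom -> r' \in dom -> r != r' ->
  [disjoint W r & W r'].
Hypothesis rr_dom : forall r r', rr r r' -> r' \in dom.
Hypothesis rr_sym : symmetric rr.
Hypothesis rr_reg : forall r r' (A B : {set V}), rr r r' ->
  A \subset W r -> B \subset W r' -> m <= q * #|A| -> m <= q * #|B| ->
  #|A| * #|B| <= D * \sum_(x in A) #|nbh x B|.

Lemma typical_vertex r r' (A B : {set V}) : rr r r' -> A \subset W r ->
  B \subset W r' -> m <= q * #|A| -> m <= q * #|B| ->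
  exists2 v, v \in A & #|B| <= D * #|nbh v B|.
Proof.
move=> rrr sA sB qA qB; have := rr_reg rrr sA sB qA qB.
case: (boolP [exists v in A, #|B| <= D * #|nbh v B|]).
  by case/existsP => v /andP[vA le] _; exists v.
move=> /exists_inPn nex; rewrite leqNgt => /negP[].
have A0 : 0 < #|A| by case: #|A| qA => //; lia.
rewrite big_distrr /= -sum_nat_const.
have [v vA] := card_gt0P A0.
rewrite (bigD1 v vA) [X in _ < X](bigD1 v vA) /= -addSn; apply: leq_add.
  by rewrite ltnNge nex.
by apply: leq_sum => x /andP[xA _]; rewrite ltnW // ltnNge nex.
Qed.

Definition next_set (s : seq R) (U Q : {set V}) := if s is t :: _ then W t :\: U else Q.

Lemma greedy_path s r v (U Q : {set V}) rQ :
  path rr r (rcons s rQ) -> Q \subset W rQ -> h <= #|Q| -> Q \subset U -> v \in U ->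
  (forall t, t \in dom -> count_mem t s + h <= #|W t :\: U| \/ t \notin s) ->
  m <= q * #|nbh v (next_set s U Q)| ->
  exists p, [/\ size p = size s, path e v p, uniq p, {in p, forall x, x \notin U}
    & exists2 z, z \in Q & e (last v p) z].
Proof.
move=> + sQ hQ; elim: s r v U => [|t s IH] r v U /= pth QU vU cnt inv.
  have : 0 < #|nbh v Q| by case: #|nbh v Q| inv => //; lia.
  case/card_gt0P => z; rewrite inE => /andP[zQ ez].
  by exists [::]; split=> //; exists z.
case/andP: pth => rt pth.
have tdom := rr_dom rt.
have [r' [rtr' sN hN]] : exists r', [/\ rr t r', next_set s U Q \subset W r'
   & h <= #|next_set s U Q|].
  case: s pth cnt {IH inv} => [|t' s] /= /andP[tt' _] cnt; first by exists rQ.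
  exists t'; split; rewrite ?subsetDl //.
  by case: (cnt t' (rr_dom tt')); rewrite ?inE ?eqxx ?orbT //; lia.
have qN : m <= q * #|next_set s U Q| by nia.
have [|v' + le'] := @typical_vertex t r' (nbh v (W t :\: U)) _ rtr' _ sN inv qN.
  by apply/subsetP => y; rewrite !inE => /andP[/andP[_ ->]].
rewrite !inE => /andP[/andP[v'U v'W] ev].
have [||||p [sp pp up pU [z zQ ez]]] := IH t v' (v' |: U) pth.
- exact: subset_trans QU (subsetUr _ _).
- by rewrite setU11.
- move=> t2 t2dom; have [->|ne] := eqVneq t2 t.
    case: (cnt t tdom); rewrite ?inE ?eqxx //= => h1; left.
    by rewrite setUC -setDDl; move: h1; rewrite (cardsD1 v' (W t :\: U)) !inE v'U v'W; clear; lia.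
  case: (cnt t2 t2dom) => h1; [left|right]; last first.
    by move: h1; rewrite inE negb_or => /andP[].
  rewrite (_ : W t2 :\: _ = W t2 :\: U); last first.
    apply/setP => y; rewrite !inE negb_or; case: eqP => //= ->.
    have dj : [disjoint W t & W t2] by apply: W_disj; rewrite // eq_sym.
    by rewrite (disjointFr dj v'W) !andbF.
  by move: h1; rewrite /= eq_sym (negPf ne).
- have -> : nbh v' (next_set s (v' |: U) Q) = nbh v' (next_set s U Q).
    case: (s) => [|t' s'] //=; apply/setP => y; rewrite !inE negb_or.
    by case: eqP => [->|] //=; rewrite e_irr andbF.
  rewrite -(leq_pmul2r D_gt0) (leq_trans qh) // -mulnA leq_mul2l.
  by rewrite [_ * D]mulnC (leq_trans hN) ?orbT.
exists (v' :: p); split=> /=; first by rewrite sp.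
- by rewrite ev.
- by rewrite up andbT; apply/negP => /pU; rewrite setU11.
- move=> x; rewrite inE => /predU1P[->//|/pU]; by rewrite inE negb_or => /andP[].
- by exists z.
Qed.

Lemma nbh_sub v B : nbh v B \subset B.
Proof. by apply/subsetP => y; rewrite inE => /andP[]. Qed.

(** Start at a vertex [v0] with many neighbours in both [W r1] and [W rQ], reserve [h] of the latter
    as [Q0], and follow the walk greedily; the last vertex has a neighbour in [Q0], which closes the
    cycle. *)
Theorem walk_embedding r0 s rQ : s != [::] -> path rr r0 (rcons s rQ) -> rr rQ r0 ->
  (forall t, count_mem t s + (2 * h).+1 <= m) ->
  exists c : seq V, [/\ size c = (size s).+2, uniq c & cycle e c].
Proof.
move=> s0 pth rQ0 cnt.
have [r1 [s' es]] : exists r1 s', s = r1 :: s' by case: s s0 {pth cnt} => // a b; exists a, b.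
have d0 := rr_dom rQ0; have dQ : rQ \in dom by rewrite rr_sym in rQ0; exact: rr_dom rQ0.
have r01 : rr r0 r1 by move: pth; rewrite es /= => /andP[].
have d1 := rr_dom r01.
have q0 : 2 <= q by lia.
pose A1 := [set v in W r0 | m <= D * #|nbh v (W rQ)|].
have cW0 := W_card d0.
have [v0] : exists2 v, v \in A1 & #|W r1| <= D * #|nbh v (W r1)|.
  apply: (@typical_vertex r0 r1) => //; last by rewrite W_card //; nia.
    by apply/subsetP => v; rewrite inE => /andP[].
  have sA : W r0 :\: A1 \subset W r0 := subsetDl _ _.
  (* By regularity fewer than [m/q] vertices of [W r0] are outside [A1]; as [q >= 2], [A1] is itself
     large enough for regularity. *)
  have : ~~ (m <= q * #|W r0 :\: A1|).
    apply/negP => qA.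
    have [||v] := @typical_vertex r0 rQ _ (W rQ) _ sA (subxx _) qA.
    - by rewrite rr_sym.
    - by rewrite W_card //; nia.
    by rewrite W_card // !inE => /andP[/nandP[/negP vW|/negP nle] vW'] le.
  have := cardsID A1 (W r0); rewrite cW0 (_ : W r0 :&: A1 = A1); first by nia.
  by apply/setIidPr/subsetP => v; rewrite inE => /andP[].
rewrite inE W_card // => /andP[v0W le0] le1.
have [|Q0 sQ cQ] := @subset_of_card _ (nbh v0 (W rQ)) h; first by nia.
have sQW := subset_trans sQ (nbh_sub _ _).
have cU : #|v0 |: Q0| <= h.+1.
  by rewrite cardsU1 cQ -add1n leq_add2r leq_b1.
have [|||t tdom||p [sp pp up pU [z zQ ez]]] := @greedy_path s r0 v0 (v0 |: Q0) Q0 rQ pth sQW.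
- by rewrite cQ.
- exact: subsetUr.
- by rewrite setU11.
(* [v0] and [Q0] occupy at most [h + 1] vertices of a cluster and [h] more stay in reserve, hence
   the [2 h + 1]. *)
- left; move: cU (cnt t); have := cardsID (v0 |: Q0) (W t).
  have := subset_leq_card (subsetIr (W t) (v0 |: Q0)); rewrite W_card //; clear; lia.
- rewrite es /=.
  have -> : nbh v0 (W r1 :\: (v0 |: Q0)) = nbh v0 (W r1) :\: Q0.
    apply/setP => y; rewrite !inE negb_or; case: eqP => [->|_] //=; last by rewrite andbA.
    by rewrite e_irr !andbF.
  have := cardsID Q0 (nbh v0 (W r1)).
  have := subset_leq_card (subsetIr (nbh v0 (W r1)) Q0); rewrite cQ.
  move: le1.
  move: #|_ :&: _| #|_ :\: _| #|nbh v0 (W r1)| => a b d le1 h1 h2.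
  (* [v0] sees at least [m/D >= 2 h] vertices of [W r1], so without [Q0] half of them remain, at
     least [m/q]. *)
  have h3 : 2 * h <= d by rewrite -(leq_pmul2l D_gt0) mulnCA mulnA (leq_trans hm).
  have h4 : d <= 2 * b by move: h1 h2 h3; clear; lia.
  apply: leq_trans le1 _; apply: (@leq_trans (2 * D * b)).
    by rewrite (mulnC 2) -mulnA leq_mul2l h4 orbT.
  by rewrite leq_mul2r qD orbT.
have ez0 : e z v0 by rewrite e_sym; have := subsetP sQ z zQ; rewrite inE => /andP[].
exists (v0 :: rcons p z); split.
- by rewrite /= size_rcons sp.
- rewrite /= rcons_uniq up andbT mem_rcons inE negb_or.
  have zU : z \in v0 |: Q0 by rewrite inE zQ orbT.
  apply/andP; split; last by apply/negP => /pU; rewrite zU.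
  apply/andP; split; last by apply/negP => /pU; rewrite setU11.
  by apply/eqP => e0; rewrite e0 e_irr in ez0.
- by rewrite /= !rcons_path pp last_rcons ez ez0.
Qed.

End Embedding.

(** * Closed walks that oscillate along prescribed edges *)

Definition touches (R : eqType) (r : R) (p : R * R) := (r == p.1) || (r == p.2).

Section ClosedWalk.
Variables (R : finType) (rr : rel R) (dom : {set R}).
Hypothesis rr_dom : forall r r', rr r r' -> r' \in dom.
Hypothesis rr_sym : symmetric rr.
Hypothesis rr_irr : irreflexive rr.

Lemma oscillation x y t : rr x y ->
  let w := flatten (nseq t [:: y; x]) in
  [/\ path rr x w, last x w = x, size w = 2 * t
    & forall r, count_mem r w <= touches r (x, y) * t].
Proof.
move=> rxy /=; elim: t => [|t [p l s c]] //=; split; rewrite ?rxy 1?rr_sym ?rxy //=.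
  by rewrite s; lia.
move=> r; have := c r; rewrite /touches /= ![_ == r]eq_sym.
have [->|_] := eqVneq r x; last by case: (r == y) => /=; lia.
have [e|_] := eqVneq x y; first by rewrite -e rr_irr in rxy.
by rewrite /=; lia.
Qed.

Lemma short_path r x : connect rr r x ->
  exists p, [/\ path rr r p, last r p = x & size p <= #|dom|].
Proof.
case/connectP => p0 /shortenP[p pp up _] ->; exists p; split=> //.
move: up => /= /andP[_ up]; rewrite -(card_uniqP up); apply: subset_leq_card.
elim: p r pp {up} => [|y p IH] r /=; first by move=> _; apply/subsetP.
case/andP=> ry pp; apply/subsetP => z; rewrite inE => /predU1P[->|zp].
  exact: rr_dom ry.
exact: (subsetP (IH _ pp)).
Qed.

(** Go to [x] along [p], oscillate [t] times along the edge, and return along [p] reversed. *)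
Lemma excursion r p t x y : path rr r p -> last r p = x -> rr x y ->
  exists w, [/\ path rr r w, last r w = r, size w = 2 * (t + size p)
    & forall z, count_mem z w <= 2 * size p + touches z (x, y) * t].
Proof.
move=> pp lp rxy; have [pw lw sw cw] := oscillation t rxy.
exists (p ++ flatten (nseq t [:: y; x]) ++ rev (belast r p)); split.
- rewrite !cat_path pp lp pw lw -lp rev_path.
  by rewrite (eq_path (e' := rr)) // => a b; rewrite rr_sym.
- by rewrite !last_cat lp lw; case: (p) lp => //= a p' _; rewrite rev_cons last_rcons.
- by rewrite !size_cat size_rev size_belast sw addnCA mulnDr [2 * size _]mul2n -addnn.
- move=> z; rewrite !count_cat; have := cw z.
  have := count_size (pred1 z) p; have := count_size (pred1 z) (rev (belast r p)).
  rewrite size_rev size_belast.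
  move: (count _ p) (count _ (rev _)) (count _ (flatten _)) (touches _ _ * t) (size p).
  by clear; lia.
Qed.

(** One excursion per edge of [Es]. Travel costs the fixed amount [base], and the oscillations are
    free up to [cap] per edge; so all even lengths in a range occur, while only vertices on edges of
    [Es] can be visited more than [2 base] times. *)
Lemma closed_walk r (Es : seq (R * R)) cap :
  (forall p, p \in Es -> connect rr r p.1 /\ rr p.1 p.2) ->
  exists2 base, base <= size Es * #|dom| & forall t, t <= size Es * cap ->
  exists w, [/\ path rr r w, last r w = r, size w = 2 * (t + base)
    & forall z, count_mem z w <= 2 * base + count (touches z) Es * cap].
Proof.
elim: Es => [|[x y] Es IH] hE.
  exists 0 => // t; rewrite mul0n leqn0 => /eqP->.
  by exists [::]; split.
have [|base leb hb] := IH; first by move=> p pE; apply: hE; rewrite inE pE orbT.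
have [/= crx rxy] := hE _ (mem_head _ _).
have [p [pp lp sp]] := short_path crx.
exists (size p + base); first by rewrite /= mulSn leq_add.
move=> t /= let_; have [w1 [p1 l1 s1 c1]] := excursion (minn t cap) pp lp rxy.
have [|w2 [p2 l2 s2 c2]] := hb (t - minn t cap); first by move: let_; rewrite mulSn; lia.
exists (w1 ++ w2); split.
- by rewrite cat_path p1 l1 p2.
- by rewrite last_cat l1 l2.
- by rewrite size_cat s1 s2; lia.
- move=> z; rewrite count_cat; have := c1 z; have := c2 z.
  by have := geq_minr t cap; case: (touches z (x, y)) => /=; nia.
Qed.

End ClosedWalk.

(** A vertex of the reduced graph meets at most one edge of [Es], so each cluster is visited at most
    [2 base + cap] times and has room for a walk of length [2 n]. *)
Theorem component_cycle (V R : finType) (e : rel V) (W : R -> {set V}) (rr : rel R)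
    (dom : {set R}) (m q D h : nat) (r : R) (Es : seq (R * R)) cap n :
  symmetric e -> irreflexive e -> 0 < m -> 0 < D ->
  m * D <= q * h -> 2 * D * h <= m -> 2 * D <= q ->
  (forall r, r \in dom -> #|W r| = m) ->
  (forall r r', r \in dom -> r' \in dom -> r != r' -> [disjoint W r & W r']) ->
  (forall r r', rr r r' -> r' \in dom) -> symmetric rr -> irreflexive rr ->
  (forall r r' (A B : {set V}), rr r r' ->
     A \subset W r -> B \subset W r' -> m <= q * #|A| -> m <= q * #|B| ->
     #|A| * #|B| <= D * \sum_(x in A) #|nbh e x B|) ->
  (forall p, p \in Es -> connect rr r p.1 /\ rr p.1 p.2) ->
  (forall z, count (touches z) Es <= 1) ->
  1 < n -> size Es * #|dom| <= n -> n <= size Es * cap ->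
  2 * (size Es * #|dom|) + cap + (2 * h).+1 <= m ->
  exists c : seq V, [/\ size c = 2 * n, uniq c & cycle e c].
Proof.
move=> e_sym e_irr m0 D0 qh hm qD Wc Wd rd rs ri rreg hE cE n1 len ncap hcap.
have [base leb hb] := closed_walk rd rs ri cap hE.
have [|w [pw lw sw cw]] := hb (n - base); first by lia.
rewrite subnK in sw; last by lia.
(* The last two entries of the walk, [rQ] and [r], stand for the closing vertex and the starting
   vertex of the cycle. *)
case: (lastP w) => [|w1 a] in pw lw sw cw *; first by rewrite /= in sw; lia.
case: (lastP w1) => [|w2 rQ] in pw lw sw cw *; first by rewrite /= in sw; lia.
rewrite last_rcons in lw; subst a.
rewrite rcons_path last_rcons in pw; case/andP: pw => pw rQr.
rewrite !size_rcons in sw.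
have [|t|c [sc uc cc]] := @walk_embedding V R e W rr dom m q D h e_sym e_irr m0 D0
  qh hm qD Wc Wd rd rs rreg r w2 rQ _ pw rQr.
- by case: (w2) sw => //=; lia.
- have := cw t; rewrite -!cats1 !count_cat; have := cE t; nia.
by exists c; split=> //; rewrite sc sw.
Qed.

(** * Copies of cycles and paths, and two counting facts *)

Lemma has_copy_cycle (G : sgraph) (c : seq G) n :
  size c = n -> uniq c -> cycle (@edge G) c -> has_copy (cycle_graph n) G.
Proof.
case: c => [|x0 c] sc uc cc.
  apply/existsP; rewrite -sc; exists (finfun (fun x : 'I_0 => False_rect G (notF (ltn_ord x)))).
  by apply/andP; split; [apply/injectiveP => -[] | apply/forallP => -[]].
have step (x y : nat) : x < n -> y = x.+1 %% n ->
    edge (nth x0 (x0 :: c) x) (nth x0 (x0 :: c) y).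
  have sc' : n = (size c).+1 by [].
  rewrite sc' => ltx ->; move/(pathP x0): cc => /(_ x); rewrite size_rcons => /(_ ltx).
  rewrite -rcons_cons nth_rcons /= ltx nth_rcons.
  case: (ltngtP x (size c)) ltx => [lt _|gt|e1 _]; last by rewrite e1 modnn.
    by rewrite modn_small.
  by rewrite ltnS leqNgt gt.
apply/existsP; exists [ffun x : 'I_n => nth x0 (x0 :: c) x]; apply/andP; split.
  apply/injectiveP => x y; rewrite !ffunE => /eqP; rewrite nth_uniq ?sc //.
  by move=> /eqP/val_inj.
apply/forallP => x; apply/forallP => y; apply/implyP => /andP[_ /orP[] /eqP e].
  by rewrite !ffunE; apply: step.
by rewrite !ffunE edge_sym; apply: step.
Qed.

Lemma has_copy_trans (F G H : sgraph) : has_copy F G -> has_copy G H -> has_copy F H.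
Proof.
case/existsP => f /andP[/injectiveP fi /forallP fe].
case/existsP => g /andP[/injectiveP gi /forallP ge].
apply/existsP; exists [ffun x => g (f x)]; apply/andP; split.
  by apply/injectiveP => x y; rewrite !ffunE => /gi/fi.
apply/forallP => x; apply/forallP => y; apply/implyP => exy; rewrite !ffunE.
have /forallP/(_ y)/implyP/(_ exy) h1 := fe x.
by have /forallP/(_ (f y))/implyP/(_ h1) := ge (f x).
Qed.

Lemma has_copy_path_cycle n : has_copy (path_graph n) (cycle_graph n).
Proof.
apply/existsP; exists [ffun x : 'I_n => x]; apply/andP; split.
  by apply/injectiveP => x y; rewrite !ffunE.
apply/forallP => x; apply/forallP => y; apply/implyP => /= exy; rewrite !ffunE.
rewrite /cycle_edge; case/orP: exy => /eqP e.
  rewrite -val_eqE /= [in _.+1 %% _]modn_small -?e // eqxx e.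
  by rewrite -[X in X == _]addn0 -addn1 eqn_add2l.
rewrite orbC -val_eqE /= [in _.+1 %% _]modn_small -?e // eqxx e.
by rewrite -addn1 -[X in _ == X]addn0 eqn_add2l.
Qed.

Lemma nbh_sum_sym (V : finType) (e : rel V) (A B : {set V}) : symmetric e ->
  \sum_(x in A) #|nbh e x B| = \sum_(y in B) #|nbh e y A|.
Proof.
move=> e_sym; rewrite (eq_bigr (fun x => \sum_(y in B) e x y)); last first.
  by move=> x _; rewrite -sum1dep_card big_mkcondr; apply: eq_bigr => y _; case: (e x y).
rewrite exchange_big /=; apply: eq_bigr => y _.
rewrite -sum1dep_card big_mkcondr; apply: eq_bigr => x _.
by rewrite e_sym; case: (e y x).
Qed.

Lemma count_le1 (T : eqType) (a : pred T) s : uniq s ->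
  {in s &, forall x y, a x -> a y -> x = y} -> count a s <= 1.
Proof.
move=> us h; rewrite -size_filter.
case E: (filter a s) (filter_uniq a us) => [|x [|y s']] //=.
have xs : x \in filter a s by rewrite E mem_head.
have ys : y \in filter a s by rewrite E !inE eqxx orbT.
move: xs ys; rewrite !mem_filter => /andP[ax xs] /andP[ay ys].
by rewrite (h x y) // mem_head.
Qed.

(** * The reduced graph on the clusters *)

Section Reduced.
Variables (N k q D : nat) (c : edge_colouring k N).
Variables (P P' : {set {set 'I_N}}) (m : nat).
Hypotheses (tP : trivIset P) (tP' : trivIset P').
Hypothesis cP : {in P, forall A : {set 'I_N}, #|A| = m}.
Hypothesis cP' : {in P', forall A : {set 'I_N}, #|A| = m}.

Notation col := (fun x y => c (x, y)).
Notation T := {set 'I_N}.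

(** A regular pair gets just one of its admissible colours and an irregular pair none, so the
    reduced graph is a partially coloured complete bipartite graph. *)
Definition rcol (A B : T) : option 'I_k :=
  if (A \in P) && (B \in P') then [pick i | lower_regular q D col i A B] else None.

Definition red i : rel (T + T) := fun u v =>
  match u, v with
  | inl A, inr B => rcol A B == Some i
  | inr B, inl A => rcol A B == Some i
  | _, _ => false
  end.

Lemma red_sym i : symmetric (red i).
Proof. by case=> A [B|B]. Qed.

Lemma red_irr i : irreflexive (red i).
Proof. by case. Qed.

Lemma rcolP i A B : rcol A B = Some i ->
  [/\ A \in P, B \in P' & lower_regular q D col i A B].
Proof.
rewrite /rcol; case: ifP => // /andP[-> ->].
by case: pickP => // j hj [<-].
Qed.

Definition dom : {set T + T} := [set inl A | A in P] :|: [set inr B | B in P'].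

Lemma inl_dom A : (inl A \in dom) = (A \in P).
Proof.
rewrite inE mem_imset; last by move=> a b [].
by rewrite orbC; case: imsetP => // -[].
Qed.

Lemma inr_dom A : (inr A \in dom) = (A \in P').
Proof.
rewrite inE [X in _ || X]mem_imset; last by move=> a b [].
by case: imsetP => // -[].
Qed.

Lemma card_dom : #|dom| <= #|P| + #|P'|.
Proof. by apply: leq_trans (leq_card_setU _ _) _; rewrite leq_add // leq_imset_card. Qed.

Lemma red_dom i r r' : red i r r' -> r' \in dom.
Proof.
case: r r' => A [B|B] //= /eqP /rcolP[h1 h2 _]; first by rewrite inr_dom.
by rewrite inl_dom.
Qed.

Definition lift_set (r : T + T) : {set 'I_N + 'I_N} :=
  match r with inl A => inl @: A | inr B => inr @: B end.

Lemma inl_inj (A B : Type) : injective (@inl A B). Proof. by move=> a b []. Qed.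
Lemma inr_inj (A B : Type) : injective (@inr A B). Proof. by move=> a b []. Qed.

Lemma card_lift r : r \in dom -> #|lift_set r| = m.
Proof.
case: r => A /=; rewrite ?inl_dom ?inr_dom card_imset.
- exact: cP.
- exact: inl_inj.
- exact: cP'.
- exact: inr_inj.
Qed.

Lemma lift_disjoint r r' : r \in dom -> r' \in dom -> r != r' ->
  [disjoint lift_set r & lift_set r'].
Proof.
move=> rd r'd ne; rewrite -setI_eq0; apply/eqP/setP => v; rewrite !inE.
apply/negP => /andP[]; move: ne rd r'd.
case: r r' => A [B|B] /= ne; rewrite ?inl_dom ?inr_dom => rd r'd /imsetP[a aA ->].
- rewrite mem_imset; last exact: inl_inj.
  have /trivIsetP/(_ A B rd r'd) h := tP; have {}h : [disjoint A & B].
    by apply: h; apply: contraNneq ne => ->.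
  by rewrite (disjointFr h aA).
- by case/imsetP.
- by case/imsetP.
- rewrite mem_imset; last exact: inr_inj.
  have /trivIsetP/(_ A B rd r'd) h := tP'; have {}h : [disjoint A & B].
    by apply: h; apply: contraNneq ne => ->.
  by rewrite (disjointFr h aA).
Qed.

Lemma colour_pairs_lift i (A B : T) :
  \sum_(x in lift_set (inl A)) #|nbh (colour_edge c i) x (lift_set (inr B))| =
  #|colour_pairs col i A B|.
Proof.
rewrite big_imset /=; last by move=> a b _ _ [].
rewrite /colour_pairs -[RHS]sum1dep_card.
rewrite (eq_bigl (fun p => (p.1 \in A) && ((p.2 \in B) && (c (p.1, p.2) == i)))); last first.
  by case=> x y; rewrite !inE /= andbA.
rewrite -(pair_big_dep (mem A) (fun x y => (y \in B) && (c (x, y) == i)) (fun _ _ => 1)) /=.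
apply: eq_bigr => x _; rewrite sum1dep_card.
rewrite (_ : nbh _ _ _ = inr @: [set y in B | c (x, y) == i]); last first.
  apply/setP => -[y|y]; rewrite !inE ?andbF.
    by apply/esym/imsetP => -[].
  by rewrite !mem_imset ?inE //; exact: inr_inj.
by rewrite card_imset //; exact: inr_inj.
Qed.

Lemma lift_preimage r (A : {set 'I_N + 'I_N}) : A \subset lift_set r ->
  exists2 r', A = lift_set r' & match r, r' with
   | inl A, inl B | inr A, inr B => B \subset A | _, _ => False end.
Proof.
move=> sA; case: r sA => R sA.
  exists (inl [set a | inl a \in A]).
    apply/setP => -[a|a] /=; first by rewrite mem_imset ?inE //; exact: inl_inj.
    transitivity false; last by apply/esym/imsetP => -[].
    by apply/negP => /(subsetP sA)/imsetP[].
  apply/subsetP => a; rewrite inE => /(subsetP sA).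
  by rewrite mem_imset //; exact: inl_inj.
exists (inr [set a | inr a \in A]).
  apply/setP => -[a|a] /=; last by rewrite mem_imset ?inE //; exact: inr_inj.
  transitivity false; last by apply/esym/imsetP => -[].
  by apply/negP => /(subsetP sA)/imsetP[].
apply/subsetP => a; rewrite inE => /(subsetP sA).
by rewrite mem_imset //; exact: inr_inj.
Qed.

Lemma red_regular_lr i R R' (A B : {set 'I_N + 'I_N}) : rcol R R' = Some i ->
  A \subset lift_set (inl R) -> B \subset lift_set (inr R') ->
  m <= q * #|A| -> m <= q * #|B| ->
  #|A| * #|B| <= D * \sum_(x in A) #|nbh (colour_edge c i) x B|.
Proof.
move=> /rcolP[RP R'P /forallP lr] /lift_preimage[[A1|A1] -> // sA]
  /lift_preimage[[B1|B1] // -> sB].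
rewrite colour_pairs_lift /= !card_imset; try exact: inl_inj; try exact: inr_inj.
move=> qA qB; have /forallP/(_ B1)/implyP := lr A1; apply.
by rewrite sA sB (cP RP) (cP' R'P) qA.
Qed.

Lemma red_regular i r r' (A B : {set 'I_N + 'I_N}) : red i r r' ->
  A \subset lift_set r -> B \subset lift_set r' -> m <= q * #|A| -> m <= q * #|B| ->
  #|A| * #|B| <= D * \sum_(x in A) #|nbh (colour_edge c i) x B|.
Proof.
case: r r' => R [R'|R'] //= /eqP e sA sB qA qB; first exact: (red_regular_lr e).
rewrite nbh_sum_sym; last exact: colour_edge_sym.
by rewrite mulnC; apply: (red_regular_lr e).
Qed.

Definition component i (u : T + T) := root (red i) u.

Lemma rcol_component i A B : rcol A B = Some i -> component i (inl A) = component i (inr B).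
Proof.
move=> e; apply/(rootP (sym_connect_sym (red_sym i))); apply: connect1.
by rewrite /= e.
Qed.

(** The closed walk oscillates along the edges of [M], which lie in one component; the number of
    clusters bounds the travel per edge. *)
Theorem reduced_matching_cycle (M : {set T * T}) i l h cap n :
  matching M ->
  (forall p, p \in M -> rcol p.1 p.2 = Some i /\ component i (inl p.1) = l) ->
  0 < m -> 0 < D -> m * D <= q * h -> 2 * D * h <= m -> 2 * D <= q ->
  1 < n -> #|M| * (#|P| + #|P'|) <= n -> n <= #|M| * cap ->
  2 * (#|M| * (#|P| + #|P'|)) + cap + (2 * h).+1 <= m ->
  has_copy (even_cycle n) (colour_class c i).
Proof.
move=> [M1 M2] hM m0 D0 qh hm qD n1 len ncap hcap.
pose Es : seq ((T + T) * (T + T)) := [seq (inl p.1, inr p.2) | p <- enum M].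
have sE : size Es = #|M| by rewrite size_map -cardE.
have ledom : #|M| * #|dom| <= #|M| * (#|P| + #|P'|) by rewrite leq_mul2l card_dom orbT.
have [p0 p0M] : exists p0, p0 \in M by apply/card_gt0P; case: #|M| ncap; rewrite ?mul0n; lia.
have csym := sym_connect_sym (red_sym i).
have [|z||||c' [sc uc cc]] := @component_cycle _ _ (colour_edge c i) lift_set (red i) dom
   m q D h (inl p0.1) Es cap n (colour_edge_sym c i) (colour_edge_irrefl c i) m0 D0
   qh hm qD card_lift lift_disjoint (@red_dom i) (red_sym i) (red_irr i) (@red_regular i)
   _ _ n1.
- move=> e /mapP[p]; rewrite mem_enum => pM ->; have [h1 h2] := hM p pM.
  have [_ h3] := hM p0 p0M; split; last by rewrite /= h1.
  by apply/(rootP csym); rewrite -!/(component _ _) h3 h2.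
- rewrite /Es count_map; apply: count_le1; first exact: enum_uniq.
  move=> p p'; rewrite !mem_enum => pM p'M; case: z => z /=; rewrite /touches /= ?orbF.
    by move=> /eqP[e1] /eqP[e2]; apply: M1 => //; rewrite -e1 -e2.
  by move=> /eqP[e1] /eqP[e2]; apply: M2 => //; rewrite -e1 -e2.
- by rewrite sE; exact: leq_trans ledom len.
- by rewrite sE.
- by apply: leq_trans hcap; rewrite sE !leq_add2r leq_mul2l.
exact: (@has_copy_cycle (colour_class c i) c' (2 * n) sc uc cc).
Qed.

End Reduced.

(** * Averaging over rows and the arithmetic of the thresholds *)

(** Markov's inequality for the number of related entries in a row, with denominators cleared. *)
Lemma few_bad_rows (U U' : finType) (P : {set U}) (P' : {set U'}) (r : U -> U' -> bool) s :
  #|[set p in setX P P' | r p.1 p.2]| * s ^ 2 <= #|P| * #|P'| -> 0 < #|P'| ->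
  #|[set A in P | #|P'| < #|[set B in P' | r A B]| * s]| * s <= #|P|.
Proof.
move=> h P'0; set bad := [set A in P | _].
rewrite -(leq_pmul2r P'0); apply: leq_trans h.
apply: (@leq_trans (\sum_(A in bad) #|[set B in P' | r A B]| * s * s)).
  rewrite mulnAC -sum_nat_const big_distrl /=; apply: leq_sum => A.
  by rewrite inE => /andP[_ /ltnW le]; rewrite leq_mul2r le orbT.
rewrite -mulnn mulnA -!big_distrl /= !leq_mul2r; apply/orP; right; apply/orP; right.
rewrite -[leqRHS]sum1dep_card.
rewrite (eq_bigl (fun p => (p.1 \in P) && ((p.2 \in P') && r p.1 p.2))); last first.
  by case=> x y; rewrite !inE /= andbA.
rewrite -(pair_big_dep (mem P) (fun x y => (y \in P') && r x y) (fun _ _ => 1)) /=.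
rewrite [leqRHS](bigID (mem bad)) /=; apply: leq_trans (leq_addr _ _).
rewrite [leqRHS](eq_bigl (mem bad)); last first.
  by move=> A; rewrite /= inE; case: (A \in P).
by apply: leq_sum => A _; rewrite sum1dep_card.
Qed.

Lemma threshold_count F K2 g s n N m p a t cap :
  0 < F -> 0 < K2 -> 0 < g -> 3 * (F * g + K2) <= s.+1 ->
  F * g * n + K2 * n <= K2 * g * N -> s * N <= s.+1 * (p * m) ->
  s * p <= s.+1 * a -> K2 * a <= F * t -> s * m <= s.+1 * cap ->
  n <= t * cap.
Proof.
move=> F0 K0 g0 hs hN hp ha ht hcap.
have s0 : 0 < s.+1 ^ 3 by rewrite expn_gt0.
have Fg0 : 0 < F * g * s.+1 ^ 3 by rewrite !muln_gt0 F0 g0.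
rewrite -(leq_pmul2l Fg0).
have c1 : K2 * g * (s ^ 3 * N) <= F * g * s.+1 ^ 3 * (t * cap).
  have e1 : s ^ 3 * N <= s.+1 * (s ^ 2 * p * m).
    apply: (@leq_trans (s ^ 2 * (s.+1 * (p * m)))); last by lia.
    by rewrite (expnSr s 2) -mulnA leq_mul2l hp orbT.
  have e2 : s ^ 2 * p * m <= s.+1 * (s * a * m).
    apply: (@leq_trans (s * m * (s.+1 * a))); last by lia.
    apply: (@leq_trans (s * m * (s * p))); first by lia.
    by rewrite leq_mul2l ha orbT.
  have e3 : s * a * m <= s.+1 * (a * cap).
    apply: (@leq_trans (a * (s.+1 * cap))); last by lia.
    apply: (@leq_trans (a * (s * m))); first by lia.
    by rewrite leq_mul2l hcap orbT.
  have e4 : s ^ 3 * N <= s.+1 ^ 3 * (a * cap).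
    have -> : s.+1 ^ 3 * (a * cap) = s.+1 * (s.+1 * (s.+1 * (a * cap))) by lia.
    apply: leq_trans e1 _; rewrite leq_mul2l; apply/orP; right.
    by apply: leq_trans e2 _; rewrite leq_mul2l e3 orbT.
  apply: (@leq_trans (g * s.+1 ^ 3 * cap * (K2 * a))).
    apply: (@leq_trans (K2 * g * (s.+1 ^ 3 * (a * cap)))); last by lia.
    by rewrite leq_mul2l e4 orbT.
  apply: (@leq_trans (g * s.+1 ^ 3 * cap * (F * t))); last by lia.
  by rewrite leq_mul2l ht orbT.
apply: leq_trans c1.
apply: (@leq_trans (s ^ 3 * (F * g * n + K2 * n))); last first.
  apply: (@leq_trans (s ^ 3 * (K2 * g * N))); last by lia.
  by rewrite leq_mul2l hN orbT.
have -> : F * g * s.+1 ^ 3 * n = s.+1 ^ 3 * (F * g) * n by lia.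
rewrite -mulnDl [s ^ 3 * _]mulnA leq_mul2r; apply/orP; right.
have cube : s.+1 ^ 3 <= s ^ 3 + 3 * s.+1 ^ 2 by lia.
have : 3 * s.+1 ^ 2 * (F * g + K2) <= s.+1 ^ 3.
  by rewrite (expnS _ 2) mulnAC leq_mul2r hs orbT.
move: (s.+1 ^ 3) (s ^ 3) (s.+1 ^ 2) cube {s0 Fg0} => x y z cube hz.
have : x * (F * g + K2) <= (y + 3 * z) * (F * g + K2) by rewrite leq_mul2r cube orbT.
have : x <= K2 * x by rewrite leq_pmull.
by lia.
Qed.

(** In units of [t], a fraction [1/(s+1)] of the [p'] clusters of a side has size at most
    [1/(40 K)], the value of [mu] below. *)
Lemma threshold_missing F K s N m p p' a t :
  0 < K -> 160 * F <= s.+1 -> 0 < s -> 0 < m ->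
  p' * m <= N -> 4 * F * m <= N -> s * N <= s.+1 * (p * m) -> s * p <= s.+1 * a ->
  2 * K * a < F * t.+1 -> 40 * K * p' <= t * s.+1.
Proof.
move=> K0 hs s0 m0 hp' hF hp ha ht.
have h1 : N <= 2 * (p * m) by nia.
have h2 : p <= 2 * a by nia.
have h3 : N <= 4 * a * m by nia.
have h4 : p' <= 4 * a by rewrite -(leq_pmul2r m0); lia.
(* Since [a >= F], rounding down in [t] costs at most half of [2 K a / F]. *)
have h5 : F <= a by have : 4 * F <= 4 * a by [rewrite -(leq_pmul2r m0); lia]; lia.
have h6 : K * a <= F * t by nia.
have h7 : 160 * (K * a) <= s.+1 * t by nia.
by nia.
Qed.

(** * Connected matchings *)

From mathcomp Require Import all_order all_algebra ring lra.
Import Order.TTheory GRing.Theory Num.Theory.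
Local Open Scope ring_scope.

Lemma card_fibers (X L : finType) (f : X -> L) (A : {set X}) :
  #|A| = (\sum_l #|[set x in A | f x == l]|)%N.
Proof.
rewrite -sum1_card (partition_big f xpredT) //=; apply: eq_bigr => l _.
by rewrite -sum1_card; apply: eq_bigl => x; rewrite inE.
Qed.

Section Size.
Variable n : nat.

(** In the application [n] is the number [t] of edges that a connected matching must exceed, not
    half the length of the cycle. *)
Definition sz (X : finType) (A : {set X}) : rat := #|A|%:R / n%:R.

Lemma sz_ge0 (X : finType) (A : {set X}) : 0 <= sz A.
Proof. by rewrite divr_ge0 ?ler0n. Qed.

Lemma sz_set0 (X : finType) : sz (set0 : {set X}) = 0.
Proof. by rewrite /sz cards0 mul0r. Qed.

Lemma le_sz (X Z : finType) (A : {set X}) (B : {set Z}) :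
  (#|A| <= #|B|)%N -> sz A <= sz B.
Proof. by move=> h; rewrite ler_wpM2r ?invr_ge0 ?ler0n // ler_nat. Qed.

Lemma szS (X : finType) (A B : {set X}) : A \subset B -> sz A <= sz B.
Proof. by move/subset_leq_card/le_sz. Qed.

Lemma szU (X : finType) (A B : {set X}) : sz (A :|: B) <= sz A + sz B.
Proof.
rewrite -mulrDl -natrD ler_wpM2r ?invr_ge0 ?ler0n // ler_nat.
by rewrite -cardsUI leq_addr.
Qed.

Lemma szUd (X : finType) (A B : {set X}) : [disjoint A & B] ->
  sz (A :|: B) = sz A + sz B.
Proof. by move=> d; rewrite /sz -mulrDl -natrD -cardsUI (disjoint_setI0 d) cards0 addn0. Qed.

Lemma szD (X : finType) (A B : {set X}) : sz A - sz B <= sz (A :\: B).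
Proof.
by rewrite lerBlDr (le_trans _ (szU _ _)) ?szS // setUC -subDset.
Qed.

Lemma sz_fibers (X L : finType) (f : X -> L) (A : {set X}) :
  sz A = \sum_l sz [set x in A | f x == l].
Proof. by rewrite /sz (card_fibers f) natr_sum mulr_suml. Qed.

Hypothesis n_gt0 : (0 < n)%N.

Lemma sz_le1 (X : finType) (A : {set X}) : (#|A| <= n)%N -> sz A <= 1.
Proof. by move=> h; rewrite ler_pdivrMr ?ltr0n // mul1r ler_nat. Qed.

Lemma sz_gt1 (X : finType) (A : {set X}) : (n < #|A|)%N -> 1 < sz A.
Proof. by move=> h; rewrite ltr_pdivlMr ?ltr0n // mul1r ltr_nat. Qed.

End Size.

(* Trivial covers for components with a side of size at most [n], so that
   [st] is dominated by both other products and the loss below is nonnegative. *)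
Lemma component_cover (X Y : finType) n (A : {set X}) (B : {set Y})
    (E : {set X * Y}) : (0 < n)%N ->
  E \subset setX A B ->
  (forall M : {set X * Y}, M \subset E -> matching M -> (#|M| <= n)%N) ->
  exists S : {set X}, exists T : {set Y},
    [/\ S \subset A, T \subset B, covers E S T, sz n S + sz n T <= 1
      & sz n S * sz n T <= (1 - sz n S) * (sz n B - sz n T) /\
        sz n S * sz n T <= (1 - sz n T) * (sz n A - sz n S)].
Proof.
move=> n0 /subsetP sE hM.
have [leA|ltA] := leqP #|A| n.
  exists A, set0; rewrite !sz_set0 sub0set; split=> //.
  - by move=> p /sE; rewrite inE => /andP[->].
  - by rewrite addr0 sz_le1.
  - have := sz_le1 n0 leA; have := sz_ge0 n B; rewrite mulr0 subrr mulr0 subr0.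
    by move=> *; split=> //; rewrite mulr_ge0 // subr_ge0.
have [leB|ltB] := leqP #|B| n.
  exists set0, B; rewrite !sz_set0 sub0set; split=> //.
  - by move=> p /sE; rewrite inE => /andP[_ ->]; rewrite orbT.
  - by rewrite add0r sz_le1.
  - have := sz_le1 n0 leB; have := sz_ge0 n A; rewrite mul0r subrr mulr0 subr0.
    by move=> *; split=> //; rewrite mulr_ge0 // subr_ge0.
have [S [T [M [sM mM cov leM]]]] := konig E.
have le1 : sz n (S :&: A) + sz n (T :&: B) <= 1.
  rewrite -mulrDl ler_pdivrMr ?ltr0n // mul1r -natrD ler_nat.
  apply: leq_trans (hM M sM mM); apply: leq_trans leM.
  by apply: leq_add; rewrite subset_leq_card // subsetIl.
exists (S :&: A), (T :&: B); rewrite !subsetIr; split=> //.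
  move=> p pE; have := cov p pE; have := sE p pE; rewrite !inE.
  by case/andP=> -> ->; rewrite !andbT.
have sA := sz_ge0 n (S :&: A); have sB := sz_ge0 n (T :&: B).
have gA := sz_gt1 n0 ltA; have gB := sz_gt1 n0 ltB.
(* From [s + t <= 1 < b] follow [t <= 1 - s] and [s <= b - t]; likewise with [a]. *)
by split; [rewrite mulrC|]; apply: ler_pM; lra.
Qed.

(** * Regions and covers of their monochromatic components *)

Section Colouring.
Variables (X Y L : finType) (k n : nat) (mu : rat).
Variables (c : X -> Y -> option 'I_k) (lx : 'I_k -> X -> L) (ly : 'I_k -> Y -> L).

Record region (A : {set X}) (B : {set Y}) (I : {set 'I_k}) : Prop := Region {
  reg_col : forall x y i, x \in A -> y \in B -> c x y = Some i -> i \in I;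
  reg_missl : forall x, x \in A -> sz n [set y in B | c x y == None] <= mu;
  reg_missr : forall y, y \in B -> sz n [set x in A | c x y == None] <= mu }.

Definition compx (A : {set X}) i l := [set x in A | lx i x == l].
Definition compy (B : {set Y}) i l := [set y in B | ly i y == l].

Record cover_system (A : {set X}) (B : {set Y})
    (S : 'I_k -> L -> {set X}) (T : 'I_k -> L -> {set Y}) : Prop := CoverSystem {
  cov_subl : forall i l, S i l \subset compx A i l;
  cov_subr : forall i l, T i l \subset compy B i l;
  cov_edge : forall x y i, x \in A -> y \in B -> c x y = Some i ->
    (x \in S i (lx i x)) || (y \in T i (ly i y));
  cov_le1 : forall i l, sz n (S i l) + sz n (T i l) <= 1;
  cov_lossl : forall i l, sz n (S i l) * sz n (T i l) <=
    (1 - sz n (S i l)) * (sz n (compy B i l) - sz n (T i l));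
  cov_lossr : forall i l, sz n (S i l) * sz n (T i l) <=
    (1 - sz n (T i l)) * (sz n (compx A i l) - sz n (S i l)) }.

End Colouring.
Arguments cov_subl {X Y L k n c lx ly A B S T}.

Lemma region_swap (X Y : finType) k n mu (c : X -> Y -> option 'I_k)
    (A : {set X}) (B : {set Y}) I :
  region n mu c A B I -> region n mu (fun y x => c x y) B A I.
Proof. by case=> h1 h2 h3; split=> // y x i yB xA; apply: h1. Qed.

Lemma cover_system_swap (X Y L : finType) k n (c : X -> Y -> option 'I_k)
    (lx : 'I_k -> X -> L) ly (A : {set X}) (B : {set Y}) S T :
  cover_system n c lx ly A B S T ->
  cover_system n (fun y x => c x y) ly lx B A T S.
Proof.
case=> h1 h2 h3 h4 h5 h6; split=> //.
- by move=> y x i yB xA e; rewrite orbC h3.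
- by move=> i l; rewrite addrC.
- by move=> i l; rewrite mulrC h6.
- by move=> i l; rewrite mulrC h5.
Qed.

Lemma cover_system_ex (X Y L : finType) k n (c : X -> Y -> option 'I_k)
    (lx : 'I_k -> X -> L) ly (A : {set X}) (B : {set Y}) : (0 < n)%N ->
  (forall x y i, c x y = Some i -> lx i x = ly i y) ->
  (forall i l (M : {set X * Y}), matching M ->
     (forall p, p \in M -> [/\ p.1 \in A, p.2 \in B, c p.1 p.2 = Some i & lx i p.1 = l]) ->
     (#|M| <= n)%N) ->
  exists S T, cover_system n c lx ly A B S T.
Proof.
move=> n0 lab hM.
pose E i l := [set p in setX (compx lx A i l) (compy ly B i l) | c p.1 p.2 == Some i].
have ex (il : 'I_k * L) : exists ST : {set X} * {set Y},
   let S := ST.1 in let T := ST.2 in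
    [/\ S \subset compx lx A il.1 il.2, T \subset compy ly B il.1 il.2,
    covers (E il.1 il.2) S T, sz n S + sz n T <= 1
      & sz n S * sz n T <= (1 - sz n S) * (sz n (compy ly B il.1 il.2) - sz n T) /\
        sz n S * sz n T <= (1 - sz n T) * (sz n (compx lx A il.1 il.2) - sz n S)].
  case: il => i l /=.
  have [||S [T H]] := @component_cover X Y n (compx lx A i l) (compy ly B i l) (E i l) n0.
  - by apply/subsetP => p; rewrite inE => /andP[].
  - move=> M /subsetP sM mM; apply: (hM i l) => // p /sM; rewrite !inE.
    by case/andP=> /andP[/andP[-> /eqP->] /andP[-> _]] /eqP->.
  by exists (S, T).
have {ex} /fin_all_exists[F hF] := ex.
exists (fun i l => (F (i, l)).1), (fun i l => (F (i, l)).2).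
split=> [i l|i l|x y i xA yB e|i l|i l|i l]; try by case: (hF (i, l)) => ? ? ? ? [].
case: (hF (i, lx i x)) => /= _ _ /(_ (x, y)) h _ _.
by rewrite -(lab _ _ _ e); apply: h; rewrite !inE /= xA yB e (lab _ _ _ e) !eqxx.
Qed.

(** * Centres, bad vertices and edge counts seen from one side *)

Section OneSide.
Variables (X Y L : finType) (k n : nat) (mu : rat).
Variables (c : X -> Y -> option 'I_k) (lx : 'I_k -> X -> L) (ly : 'I_k -> Y -> L).
Variables (A : {set X}) (B : {set Y}) (I : {set 'I_k}).
Variables (S : 'I_k -> L -> {set X}) (T : 'I_k -> L -> {set Y}).
Hypothesis lab : forall x y i, c x y = Some i -> lx i x = ly i y.
Hypothesis regAB : region n mu c A B I.
Hypothesis covAB : cover_system n c lx ly A B S T.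

Notation sz := (sz n).

Definition nbr i x := [set y in B | c x y == Some i].
(* [S i l] and [T i l] cover the edges of colour [i] in the component labelled [l]. *)
Definition centres x := [set i in I | x \in S i (lx i x)].
Definition bad i := [set x in A | centres x == [set i]].

Lemma nbr_sub i x : nbr i x \subset compy ly B i (lx i x).
Proof.
by apply/subsetP => y; rewrite !inE => /andP[-> /eqP/lab->]; rewrite eqxx.
Qed.

Lemma nbr_le i x : x \in A -> x \notin S i (lx i x) -> sz (nbr i x) <= sz (T i (lx i x)).
Proof.
move=> xA xS; apply: szS; apply/subsetP => y; rewrite inE => /andP[yB /eqP e].
by have := cov_edge covAB xA yB e; rewrite (negPf xS) /= (lab e).
Qed.

Lemma sz_T_le1 i l : sz (T i l) <= 1.
Proof. by have := cov_le1 covAB i l; have := sz_ge0 n (S i l); lra. Qed.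

Lemma sz_S_le1 i l : sz (S i l) <= 1.
Proof. by have := cov_le1 covAB i l; have := sz_ge0 n (T i l); lra. Qed.

Lemma degree_sum x : x \in A -> sz B <= mu + \sum_(i in I) sz (nbr i x).
Proof.
move=> xA; rewrite (sz_fibers n (c x)) (bigD1 None) //=.
apply: lerD; first exact: (reg_missl regAB).
rewrite (reindex_omap Some id) /=; last by case.
rewrite big_mkcond [leRHS]big_mkcond /=; apply: ler_sum => i _.
rewrite eqxx /=; case: ifP => iI //; rewrite /sz.
rewrite (_ : [set _ in _ | _] = set0) ?cards0 ?mul0r //.
apply/setP => y; rewrite !inE; apply/negP => /andP[yB /eqP e].
by rewrite (reg_col regAB xA yB e) in iI.
Qed.

Lemma noncentre_degree x (J : {set 'I_k}) : x \in A ->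
  (forall i, i \in J -> x \notin S i (lx i x)) ->
  \sum_(i in J) sz (nbr i x) <= #|J|%:R.
Proof.
move=> xA h; rewrite -sum1_card natr_sum; apply: ler_sum => i /h xS.
exact: le_trans (nbr_le xA xS) (sz_T_le1 _ _).
Qed.

(** A colour of which [x] is not a centre reaches weight at most 1 of [B]; all colours together
    would not fill [B]. *)
Lemma centres_gt0 x : mu + #|I|%:R < sz B -> x \in A -> (0 < #|centres x|)%N.
Proof.
move=> hB xA; rewrite lt0n cards_eq0; apply: contraTneq hB => e0.
rewrite -leNgt (le_trans (degree_sum xA)) // lerD2l noncentre_degree // => i iI.
by apply/negP => xS; have := in_set0 i; rewrite -e0 inE iI xS.
Qed.

Lemma bad_degree i x : i \in I -> x \in bad i -> sz B - mu - (#|I|%:R - 1) <= sz (nbr i x).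
Proof.
move=> iI; rewrite inE => /andP[xA /eqP ex].
have := degree_sum xA; rewrite (bigD1 i) //=.
have := @noncentre_degree x (I :\ i) xA.
rewrite (cardsD1 i I) iI natrD /=.
have -> : \sum_(j in I | j != i) sz (nbr j x) = \sum_(j in I :\ i) sz (nbr j x).
  by apply: eq_bigl => j; rewrite !inE andbC.
set d := \sum_(j in _) _.
move=> h; have {h} : d <= #|I :\ i|%:R.
  apply: h => j; rewrite !inE => /andP[ne jI]; apply/negP => xS.
  have : j \in centres x by rewrite inE jI xS.
  by rewrite ex inE (negPf ne).
by lra.
Qed.

(** Every vertex is a centre of some colour, and of two unless it is bad; counting bad vertices once
    more gives two per vertex. *)
Lemma centre_count : mu + #|I|%:R < sz B ->
  2 * sz A <= \sum_(i in I) (\sum_l sz (S i l) + sz (bad i)).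
Proof.
move=> hB; rewrite /sz mulrA.
have -> : \sum_(i in I) (\sum_l #|S i l|%:R / n%:R + #|bad i|%:R / n%:R) =
   (\sum_(i in I) (\sum_l #|S i l| + #|bad i|))%:R / n%:R :> rat.
  rewrite natr_sum mulr_suml; apply: eq_bigr => i _.
  by rewrite natrD mulrDl natr_sum mulr_suml.
rewrite ler_wpM2r ?invr_ge0 ?ler0n // -natrM ler_nat.
have -> : (\sum_(i in I) (\sum_l #|S i l| + #|bad i|) =
  \sum_(x in A) (\sum_(i in I) ((x \in S i (lx i x)) + (centres x == [set i]))))%N.
  rewrite exchange_big /=; apply: eq_bigr => i iI.
  rewrite big_split /=; congr (_ + _)%N.
    rewrite (_ : \sum_(x in A) _ = #|[set x in A | x \in S i (lx i x)]|)%N; last first.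
      by rewrite -sum1dep_card big_mkcondr /=; apply: eq_bigr => x _; case: (_ \in _).
    rewrite (card_fibers (lx i)); apply: eq_bigr => l _; apply: eq_card => x.
    have := subsetP (cov_subl covAB i l) x.
    rewrite !inE; case: (boolP (x \in S i l)) => [xS /(_ isT)/andP[-> /eqP el]|xS _].
      by rewrite -el in xS; rewrite xS el eqxx.
    by apply/esym/negP => /andP[/andP[_ h] /eqP el]; rewrite el (negPf xS) in h.
  rewrite -sum1dep_card big_mkcondr /=.
  by apply: eq_bigr => x _; case: (_ == _).
rewrite mulnC -sum_nat_const; apply: leq_sum => x xA.
rewrite big_split /=.
have -> : (\sum_(i in I) (x \in S i (lx i x)) = #|centres x|)%N.
  by rewrite -sum1dep_card big_mkcondr /=; apply: eq_bigr => i _; case: (_ \in _).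
have := centres_gt0 hB xA; have [le2 _|] := leqP 2 #|centres x|.
  exact: leq_trans le2 (leq_addr _ _).
move=> lt2 gt0; have {lt2 gt0} e : #|centres x| = 1%N by lia.
rewrite e.
have /cards1P[i ei] : #|centres x| == 1%N by rewrite e.
have iI : i \in I by move: (set11 i); rewrite -ei inE => /andP[].
by rewrite (bigD1 i) //= ei eqxx.
Qed.

Definition edges i := (\sum_(x in A) sz (nbr i x)) / n%:R.

(** The slack of colour [i] in the edge count; it compensates for an excess of bad vertices. *)
Definition loss i := \sum_l ((1 - sz (S i l)) * (sz (compy ly B i l) - sz (T i l))
  + (1 - sz (T i l)) * (sz (compx lx A i l) - sz (S i l)) - sz (S i l) * sz (T i l)).

Lemma edges_ge : sz A * (sz B - mu) <= \sum_(i in I) edges i.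
Proof.
rewrite -mulr_suml exchange_big /= /sz mulrAC ler_wpM2r ?invr_ge0 ?ler0n //.
rewrite mulrC mulr_natr -sumr_const; apply: ler_sum => x xA.
by rewrite lerBlDl; apply: degree_sum.
Qed.

(** In a component with sides [a], [b] and cover [s], [t] a centre has at most [b] neighbours and
    any other vertex of [A] at most [t]. The bound [s b + (a - s) t] equals [(a - s) + (b - t)]
    minus the summand of [loss]. *)
Lemma edges_le i : edges i <=
  sz A - \sum_l sz (S i l) + (sz B - \sum_l sz (T i l)) - loss i.
Proof.
rewrite (sz_fibers n (lx i) A) (sz_fibers n (ly i) B) -!sumrB -big_split /= -sumrB.
rewrite /edges (partition_big (lx i) xpredT) //= mulr_suml.
apply: ler_sum => l _; rewrite -/(compx lx A i l) -/(compy ly B i l).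
have sS := cov_subl covAB i l.
apply: (@le_trans _ _ ((#|S i l|%:R * sz (compy ly B i l) +
   (#|compx lx A i l|%:R - #|S i l|%:R) * sz (T i l)) / n%:R)).
  rewrite ler_wpM2r ?invr_ge0 ?ler0n //.
  rewrite (bigID (mem (S i l))) /=; apply: lerD.
    rewrite (eq_bigl (mem (S i l))); last first.
      move=> x; rewrite /= andbC; case: (boolP (x \in S i l)) => //= xS.
      by have := subsetP sS x xS; rewrite inE.
    rewrite mulrC mulr_natr -sumr_const; apply: ler_sum => x xS.
    apply: szS; have := subsetP sS x xS; rewrite inE => /andP[_ /eqP <-].
    exact: nbr_sub.
  rewrite (eq_bigl (mem (compx lx A i l :\: S i l))); last first.
    by move=> x; rewrite !inE andbC.
  rewrite -natrB ?subset_leq_card // -(setIidPr sS) -cardsD mulrC mulr_natr.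
  rewrite (setIidPr sS) -sumr_const.
  apply: ler_sum => x; rewrite !inE => /and3P[xS xA /eqP el].
  by rewrite -el; apply: nbr_le; rewrite ?el.
rewrite le_eqVlt; apply/orP; left; apply/eqP.
rewrite mulrDl mulrAC -[_ * _ / _ in X in _ + X]mulrAC mulrBl -/(sz _) -/(sz _).
by ring.
Qed.

Lemma loss_term_ge i l : (1 - sz (S i l)) * (sz (compy ly B i l) - sz (T i l)) <=
 (1 - sz (S i l)) * (sz (compy ly B i l) - sz (T i l))
  + (1 - sz (T i l)) * (sz (compx lx A i l) - sz (S i l)) - sz (S i l) * sz (T i l).
Proof. by rewrite -addrA lerDl subr_ge0 (cov_lossr covAB). Qed.

Lemma loss_part_ge0 i l : 0 <= (1 - sz (S i l)) * (sz (compy ly B i l) - sz (T i l)).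
Proof.
by apply: mulr_ge0; rewrite subr_ge0 ?sz_S_le1 // szS // (cov_subr covAB).
Qed.

Lemma loss_ge0 i : 0 <= loss i.
Proof.
apply: sumr_ge0 => l _; exact: le_trans (loss_part_ge0 _ _) (loss_term_ge _ _).
Qed.

End OneSide.

Lemma nonmissing2 (Y : finType) n (mu : rat) (N1 N2 B : {set Y}) :
  sz n N1 <= mu -> sz n N2 <= mu -> 2 * mu < sz n B ->
  exists2 y, y \in B & (y \notin N1) && (y \notin N2).
Proof.
move=> h1 h2 hB; have [|/subsetPn[y yB]] := boolP (B \subset N1 :|: N2).
  by move/(szS n); have := szU n N1 N2; lra.
by rewrite inE negb_or; exists y.
Qed.

(** * Combining the two sides: the edge count and the deletion of a colour *)

Section TwoSides.
Variables (X Y L : finType) (k n : nat) (mu : rat).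
Variables (c : X -> Y -> option 'I_k) (lx : 'I_k -> X -> L) (ly : 'I_k -> Y -> L).
Variables (A : {set X}) (B : {set Y}) (I : {set 'I_k}).
Variables (S : 'I_k -> L -> {set X}) (T : 'I_k -> L -> {set Y}).
Hypothesis n_gt0 : (0 < n)%N.
Hypothesis mu_ge0 : 0 <= mu.
Hypothesis lab : forall x y i, c x y = Some i -> lx i x = ly i y.
Hypothesis regAB : region n mu c A B I.
Hypothesis covAB : cover_system n c lx ly A B S T.

Notation sz := (sz n).
Let lab' y x i : c x y = Some i -> ly i y = lx i x.
Proof. by move/lab. Qed.
Let regBA := region_swap regAB.
Let covBA := cover_system_swap covAB.

Notation badx := (bad lx A I S).
Notation bady := (bad ly B I T).
Notation lossx := (loss n lx ly A B S T).

Lemma loss_swap i : loss n ly lx B A T S i = lossx i.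
Proof.
by apply: eq_bigr => l _; rewrite [sz (T _ _) * _]mulrC [_ * _ + _]addrC.
Qed.

(** Sum [edges_le] over the colours: by [centre_count] on both sides, centres and bad vertices
    contribute at least [2 sz A + 2 sz B]. *)
Lemma stage_count : mu + #|I|%:R < sz A -> mu + #|I|%:R < sz B ->
  (forall i, i \in I -> sz (badx i) + sz (bady i) <= 1 + 2 * mu + lossx i) ->
  sz A * (sz B - mu) <= (#|I|%:R - 2) * (sz A + sz B) + #|I|%:R * (1 + 2 * mu).
Proof.
move=> hA hB hbad.
have cx := centre_count lab regAB covAB hB.
have cy := centre_count lab' regBA covBA hA.
apply: le_trans (edges_ge regAB) _.
have : \sum_(i in I) edges n c A B i <= \sum_(i in I) (sz A + sz B + (1 + 2 * mu)
   - (\sum_l sz (S i l) + sz (badx i)) - (\sum_l sz (T i l) + sz (bady i))).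
  apply: ler_sum => i iI; have := hbad i iI; have := edges_le lab covAB i; lra.
move/le_trans; apply.
rewrite !sumrB sumr_const -mulr_natl; lra.
Qed.

(** By the cover, one end of the edge is a centre of its colour, and a bad vertex is a centre of one
    colour only. *)
Lemma bad_edge i j x y : x \in badx i -> y \in bady i -> c x y = Some j -> j = i.
Proof.
rewrite !inE => /andP[xA /eqP ex] /andP[yB /eqP ey] e.
have jI := reg_col regAB xA yB e.
case/orP: (cov_edge covAB xA yB e) => h; apply/set1P.
  by rewrite -ex inE jI.
by rewrite -ey inE jI.
Qed.

Lemma bad_centre i x : i \in I -> x \in badx i -> x \in S i (lx i x).
Proof.
move=> iI; rewrite inE => /andP[_ /eqP e].
by have := set11 i; rewrite -e inE => /andP[].
Qed.

Lemma bad_centre' i y : i \in I -> y \in bady i -> y \in T i (ly i y).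
Proof.
move=> iI; rewrite inE => /andP[_ /eqP e].
by have := set11 i; rewrite -e inE => /andP[].
Qed.

(** Between bad vertices of the two sides all pairs that are not missing have colour [i]. So any two
    on the left have a common neighbour, all bad vertices lie in one component, and its cover, of
    size at most 1, contains them. *)
Lemma bad_both i : i \in I -> 2 * mu < sz (badx i) -> 2 * mu < sz (bady i) ->
  sz (badx i) + sz (bady i) <= 1.
Proof.
move=> iI hx hy.
have [x0 x0b] : exists x0, x0 \in badx i.
  apply/set0Pn; apply: contraTneq hx => ->; by rewrite sz_set0 -leNgt mulr_ge0.
have common x x' : x \in badx i -> x' \in badx i ->
    exists2 y, y \in bady i & c x y = Some i /\ c x' y = Some i.
  move=> xb x'b; have xA : x \in A by move: xb; rewrite inE => /andP[].
  have x'A : x' \in A by move: x'b; rewrite inE => /andP[].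
  have [y yb] := nonmissing2 (reg_missl regAB xA) (reg_missl regAB x'A) hy.
  have yB : y \in B by move: yb; rewrite inE => /andP[].
  rewrite !inE yB /= => /andP[]; case e: (c x y) => [j|] // _; case e': (c x' y) => [j'|] // _.
  by exists y => //; rewrite e e' (bad_edge xb yb e) (bad_edge x'b yb e').
pose l := lx i x0.
have hxl : badx i \subset S i l.
  apply/subsetP => x xb; have [y _ [e e']] := common _ _ xb x0b.
  by rewrite /l (lab e') -(lab e) bad_centre.
have hyl : bady i \subset T i l.
  apply/subsetP => y yb; have yB : y \in B by move: yb; rewrite inE => /andP[].
  have [x xb] := nonmissing2 (reg_missr regAB yB) (reg_missr regAB yB) hx.
  have xA : x \in A by move: xb; rewrite inE => /andP[].
  rewrite !inE xA /= andbb; case e: (c x y) => [j|] // _.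
  have ji := bad_edge xb yb e; rewrite {}ji in e; have [y' _ [e1 e2]] := common _ _ xb x0b.
  by rewrite /l (lab e2) -(lab e1) (lab e) bad_centre'.
by have := szS n hxl; have := szS n hyl; have := cov_le1 covAB i l; lra.
Qed.

(** By [bad_both] one side has bad vertices of size at most [2 mu], so the other has the rest. *)
Lemma bad_split i : i \in I -> 1 + 2 * mu + lossx i < sz (badx i) + sz (bady i) ->
  (1 + lossx i < sz (badx i)) \/ (1 + lossx i < sz (bady i)).
Proof.
move=> iI h; have l0 := loss_ge0 covAB i.
have [hx|hx] := ltP (1 + lossx i) (sz (badx i)); first by left.
have [hy|hy] := ltP (1 + lossx i) (sz (bady i)); first by right.
have hx2 : 2 * mu < sz (badx i) by lra.
have hy2 : 2 * mu < sz (bady i) by lra.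
by have := bad_both iI hx2 hy2; have := mu_ge0; lra.
Qed.

(** A bad vertex sends at least [Y0] edges of colour [i] into its component. The bad vertices do not
    fit into one cover, and [B] has no room for three such components, so they meet exactly two.
    Restricting [B] to these and deleting both covers removes colour [i]. [w] is what the two left
    covers lack to size 2; as the bad vertices outweigh the loss, it is small. *)
Lemma double_reduction i (Y0 := sz B - mu - (#|I|%:R - 1)) :
  i \in I -> sz B < 3 * Y0 -> 1 + lossx i < sz (badx i) ->
  exists w, exists A' : {set X}, exists B' : {set Y},
    [/\ region n mu c A' B' (I :\ i), A' \subset A /\ B' \subset B,
        [/\ 0 <= w, w < 1 & w * (Y0 + 1 - w) < 1],
        sz A - 2 + w <= sz A' /\ 2 * Y0 - w <= sz B' & 2 * Y0 <= sz B].
Proof.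
move=> iI hB hbad; have l0 := loss_ge0 covAB i.
have compY x : x \in badx i -> Y0 <= sz (compy ly B i (lx i x)).
  move=> xb; apply: le_trans (bad_degree lab regAB covAB iI xb) _.
  by apply: szS; apply: nbr_sub.
have [x1 x1b] : exists x1, x1 \in badx i.
  apply/set0Pn; apply: contraTneq hbad => ->; rewrite sz_set0 -leNgt; lra.
pose l1 := lx i x1.
have [x2 x2b ne] : exists2 x2, x2 \in badx i & lx i x2 != l1.
  have [/subsetPn[x2 x2b x2S]|] := boolP (~~ (badx i \subset S i l1)).
    exists x2 => //; apply: contraNneq x2S => <-; exact: bad_centre.
  by rewrite negbK => /(szS n); have := sz_S_le1 covAB i l1; lra.
pose l2 := lx i x2.
have disj l l' : l != l' -> [disjoint compy ly B i l & compy ly B i l'].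
  move=> nl; rewrite -setI_eq0; apply/eqP/setP => y; rewrite !inE.
  by apply/negP => /andP[/andP[_ /eqP e] /andP[_ /eqP e']]; rewrite -e e' eqxx in nl.
have y12 : sz (compy ly B i l1 :|: compy ly B i l2) =
   sz (compy ly B i l1) + sz (compy ly B i l2).
  by rewrite szUd // disj // eq_sym.
have sub12 : compy ly B i l1 :|: compy ly B i l2 \subset B.
  by apply/subsetP => y; rewrite !inE => /orP[] /andP[].
have in12 x : x \in badx i -> (lx i x == l1) || (lx i x == l2).
  move=> xb; apply: contraT; rewrite negb_or => /andP[n1 n2].
  have : sz ((compy ly B i l1 :|: compy ly B i l2) :|: compy ly B i (lx i x)) <= sz B.
    by apply: szS; rewrite subUset sub12; apply/subsetP => y; rewrite !inE => /andP[].
  rewrite szUd ?y12; last first.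
    rewrite -setI_eq0 setIUl !(disjoint_setI0 _) ?setU0 // disj // eq_sym //.
  by have := compY _ xb; have := compY _ x1b; have := compY _ x2b; rewrite -/l1 -/l2; lra.
have badS : badx i \subset S i l1 :|: S i l2.
  apply/subsetP => x xb; rewrite inE; have := bad_centre iI xb.
  by case/orP: (in12 _ xb) => /eqP-> ->; rewrite ?orbT.
have hs := le_trans (szS n badS) (szU n _ _).
have hloss : (1 - sz (S i l1)) * (sz (compy ly B i l1) - sz (T i l1)) +
   (1 - sz (S i l2)) * (sz (compy ly B i l2) - sz (T i l2)) <= lossx i.
  rewrite /loss (bigD1 l1) //= (bigD1 l2) //= addrA -[leLHS]addr0.
  apply: lerD; last first.
    apply: sumr_ge0 => l _.
    exact: le_trans (loss_part_ge0 covAB i l) (loss_term_ge covAB i l).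
  by apply: lerD; apply: (loss_term_ge covAB).
have Y1 := compY _ x1b; have Y2 := compY _ x2b; rewrite -/l1 -/l2 in Y1 Y2.
have c1 := cov_le1 covAB i l1; have c2 := cov_le1 covAB i l2.
have a1 := sz_S_le1 covAB i l1; have a2 := sz_S_le1 covAB i l2.
have szB := szS n sub12; rewrite y12 in szB.
exists (2 - sz (S i l1) - sz (S i l2)), (A :\: (S i l1 :|: S i l2)),
  ((compy ly B i l1 :|: compy ly B i l2) :\: (T i l1 :|: T i l2)).
split; last by lra.
- split.
  + move=> x y j; rewrite !inE !negb_or => /andP[/andP[xS1 xS2] xA].
    case/andP=> /andP[yT1 yT2] hy e.
    have yB : y \in B by case/orP: hy => /andP[].
    rewrite (reg_col regAB xA yB e) andbT; apply/eqP => ji; rewrite {}ji in e.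
    have := cov_edge covAB xA yB e; rewrite (lab e).
    by case/orP: hy => /andP[_ /eqP->]; rewrite ?(negPf xS1) ?(negPf xS2)
       ?(negPf yT1) ?(negPf yT2).
  + move=> x; rewrite inE => /andP[_ xA]; apply: le_trans (reg_missl regAB xA).
    apply: szS; apply/subsetP => y; rewrite !inE => /andP[/andP[_ +] ->].
    by case/orP=> /andP[->].
  + move=> y; rewrite !inE => /andP[_ hy].
    have yB : y \in B by case/orP: hy => /andP[].
    apply: le_trans (reg_missr regAB yB).
    by apply: szS; apply/subsetP => x; rewrite !inE => /andP[/andP[_ ->] ->].
- split; first exact: subsetDl.
  exact: subset_trans (subsetDl _ _) sub12.
- set s1 := sz (S i l1) in hs hloss c1 a1 *; set s2 := sz (S i l2) in hs hloss c2 a2 *.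
  set y1 := sz (compy _ _ _ _) in hloss Y1; set y2 := sz (compy _ _ _ _) in hloss Y2.
  set t1 := sz (T i l1) in hloss c1; set t2 := sz (T i l2) in hloss c2.
  have p1 : (1 - s1) * (Y0 - (1 - s1)) <= (1 - s1) * (y1 - t1).
    by apply: ler_wpM2l; lra.
  have p2 : (1 - s2) * (Y0 - (1 - s2)) <= (1 - s2) * (y2 - t2).
    by apply: ler_wpM2l; lra.
  (* This gives [(1 - s1)^2 + (1 - s2)^2 <= w^2], so by [p1] and [p2] the loss is at least
     [w (Y0 - w)]; it is also below [1 - w]. *)
  have p3 : 0 <= (1 - s1) * (1 - s2) by apply: mulr_ge0; lra.
  split; try lra; nra.
- have := szD n A (S i l1 :|: S i l2); have := szU n (S i l1) (S i l2).
  have := szD n (compy ly B i l1 :|: compy ly B i l2) (T i l1 :|: T i l2).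
  have := szU n (T i l1) (T i l2); rewrite y12; lra.
Qed.

End TwoSides.

(* Lower bounds for the size of a side minus [2 * u] after [l] deletions have
   doubled this difference; at level 3 it is too large for another one. *)
Definition level (K : nat) (l : nat) : rat :=
  match l with 0 => 1 / 2 + 1 / K%:R | 1 => 1 | 2 => 8 / 5 | _ => 5 / 2 end.

(** * Numerical estimates for the levels *)

Section Numeric.
Variables (K la lb u : nat) (mu : rat).
Hypotheses (K6 : (6 <= K)%N) (eK : (la + lb + u)%N = K).
Hypotheses (la3 : (la <= 3)%N) (lb3 : (lb <= 3)%N).
Hypothesis (emu : mu = 1 / (40 * K%:R)).

Lemma K6r : (6 : rat) <= K%:R. Proof. by rewrite (ler_nat _ 6). Qed.

Lemma invK_gt0 : 0 < 1 / K%:R :> rat.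
Proof. by have := K6r; move=> h; apply: divr_gt0; lra. Qed.

Lemma mulKinv : K%:R * (1 / K%:R) = 1 :> rat.
Proof. by have := K6r; move=> h; field; apply/eqP; lra. Qed.

Lemma muE : mu = 1 / 40 * (1 / K%:R).
Proof. by rewrite emu; have := K6r => h; field; apply/eqP; lra. Qed.

Lemma invK_le : 1 / K%:R <= 1 / 6 :> rat.
Proof. by have := K6r; have := invK_gt0; have := mulKinv; nra. Qed.

Lemma level_gt l : 1 / 2 < level K l.
Proof. by have := invK_gt0; case: l => [|[|[|l]]] /=; lra. Qed.

(** For sides [2 U + Da] and [2 U + Db] the inequality reads [U (Da + Db - 1) + Da Db <= 2], up to
    an error of at most [1/8] from [mu]. The tightest case is level 0 on both sides, where the left
    side is at least [2 + (1/2 + 1/K)^2]. *)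
Lemma level_count (a b : rat) :
  level K la <= a - 2 * u%:R -> level K lb <= b - 2 * u%:R ->
  a <= 2 * K%:R + 2 ->
  a * (b - mu) <= u%:R * (a + b) + (u%:R + 2) * (1 + 2 * mu) -> False.
Proof.
set U : rat := u%:R; set Da := a - 2 * U; set Db := b - 2 * U => ha hb leA cnt.
have eKr : K%:R = la%:R + lb%:R + U :> rat by rewrite -!natrD eK.
have k6 := K6r; have ik := invK_gt0; have mk := mulKinv; have ile := invK_le.
have emu' := muE; have ga := level_gt la; have gb := level_gt lb.
have U0 : 0 <= U by rewrite ler0n.
have lar : 0 <= la%:R :> rat by rewrite ler0n.
have lbr : 0 <= lb%:R :> rat by rewrite ler0n.
have main : U * (level K la + level K lb - 1) + level K la * level K lb <= 17 / 8.
  have h1 : U * (level K la + level K lb - 1) <= U * (Da + Db - 1).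
    by apply: ler_wpM2l; [exact: U0 | rewrite lerD2r; apply: lerD; [exact: ha | exact: hb]].
  have h2 : level K la * level K lb <= Da * Db by apply: ler_pM; lra.
  have h3 : mu * (2 * (U + 2) + a) <= 1 / 8.
    have : mu * (2 * (U + 2) + a) <= mu * (4 * K%:R + 6).
      by apply: ler_wpM2l; lra.
    by rewrite emu'; nra.
  have : U * (Da + Db - 1) + Da * Db = a * b - U * (a + b) - U by rewrite /Da /Db; ring.
  by lra.
have Ur : U = K%:R - la%:R - lb%:R by lra.
move: main; rewrite Ur.
move: la3 lb3; case: (la) => [|[|[|[|//]]]] _; case: (lb) => [|[|[|[|//]]]] _ /=;
  rewrite ?mulr0n ?mulr1n; have := sqr_ge0 (1 / K%:R : rat); lra.
Qed.

Lemma level_degree (b : rat) : level K lb <= b - 2 * u%:R ->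
  mu + (u%:R + 2) < b /\ b < 3 * (b - mu - (u%:R + 2 - 1)).
Proof.
have eKr : K%:R = la%:R + lb%:R + u%:R :> rat by rewrite -!natrD eK.
have k6 := K6r; have ik := invK_gt0; have mk := mulKinv; have ile := invK_le.
have emu' := muE.
have lar : la%:R <= 3 :> rat by rewrite (ler_nat _ _ 3).
move: lb3 eKr; case: (lb) => [|[|[|[|//]]]] _ /=; lra.
Qed.

(** Writing [b = 2 u + Db], a deletion replaces [Db] by [2 Db - 2 mu - w]. The hypothesis
    [2 Y0 <= b] means [Db <= 2 + 2 mu], which level 3 exceeds. *)
Lemma level_step (b w : rat) (Y0 := b - mu - (u%:R + 2 - 1)) :
  level K lb <= b - 2 * u%:R -> 0 <= w -> w < 1 -> w * (Y0 + 1 - w) < 1 ->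
  2 * Y0 <= b ->
  (lb < 3)%N /\ level K lb.+1 <= 2 * Y0 - w - 2 * (u%:R - 1).
Proof.
move=> hb w0 w1 hw leY.
have eKr : K%:R = la%:R + lb%:R + u%:R :> rat by rewrite -!natrD eK.
have k6 := K6r; have ik := invK_gt0; have mk := mulKinv; have ile := invK_le.
have emu' := muE.
have lar : la%:R <= 3 :> rat by rewrite (ler_nat _ _ 3).
(* [w (E - w)] is concave in [w]: it exceeds 1 at [w0] and at 1, so [w < w0] *)
have concave (w0' E : rat) : 0 < w0' -> w0' < 1 -> E <= Y0 + 1 -> 2 <= E ->
    1 <= w0' * (E - w0') -> w <= w0'.
  move=> p1 p2 hE E2 p3; rewrite leNgt; apply/negP => lt.
  have : 0 <= (w - w0') * (1 - w) by apply: mulr_ge0; lra.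
  have : w * (E - w) <= w * (Y0 + 1 - w) by apply: ler_wpM2l; lra.
  have : w0' * (E - 1 - w0') <= w * (E - 1 - w0') by apply: ler_wpM2r; nra.
  by lra.
move: lb3 hb eKr; rewrite /Y0 in concave hw leY *.
case: (lb) => [|[|[|[|//]]]] _ /= hb eKr.
(* [Y0 + 1] is [u + Db - mu] with [u >= K - 3 - lb]; this gives the values of [E]. *)
- have : w <= 2 * (1 / K%:R) - 2 * mu; last by clear concave; split; [exact: isT | lra].
  apply: (@concave _ (K%:R - 3 + 1 / 2 + 1 / K%:R - mu)); rewrite emu'; try lra.
  by have := sqr_ge0 (1 / K%:R : rat); nra.
- have : w <= 39 / 100 by apply: (@concave _ (3 - mu)); lra.
  by clear concave; split; [exact: isT | lra].
- have : w <= 69 / 100 by apply: (@concave _ (13 / 5 - mu)); lra.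
  by clear concave; split; [exact: isT | lra].
- by lra.
Qed.

End Numeric.

Lemma sz_trim (X : finType) n (A : {set X}) (f : rat) : (0 < n)%N -> f <= sz n A ->
  exists A' : {set X}, [/\ A' \subset A, f <= sz n A' & sz n A' <= Num.max 0 f + 1].
Proof.
move=> n0 hA; have n0r : 0 < n%:R :> rat by rewrite ltr0n.
have ex : exists t : nat, f * n%:R <= t%:R by exists #|A|; rewrite -ler_pdivlMr.
have [] := ex_minnP ex => t ht tmin.
have [|A' sA eA] := @subset_of_card _ A t; first by apply: tmin; rewrite -ler_pdivlMr.
exists A'; split; rewrite ?sA // /sz eA ?ler_pdivlMr // ler_pdivrMr // mulrDl mul1r.
have [-> |t0] := posnP t.
  by rewrite addr_ge0 ?mulr_ge0 ?ler0n // le_max lexx.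
have : t.-1%:R < f * n%:R.
  by rewrite ltNge; apply/negP => /tmin; rewrite leqNgt ltn_predL t0.
have -> : t%:R = t.-1%:R + 1 :> rat by rewrite natr1 prednK.
move=> lt; apply: lerD; last by rewrite ler1n.
apply: le_trans (ltW lt) _; apply: ler_wpM2r; first exact: ltW.
by rewrite le_max lexx orbT.
Qed.

(** * Repeated deletion of colours *)

Section Main.
Variables (X Y L : finType) (k n K : nat).
Variables (c : X -> Y -> option 'I_k) (lx : 'I_k -> X -> L) (ly : 'I_k -> Y -> L).
Hypothesis n_gt0 : (0 < n)%N.
Hypothesis K6 : (6 <= K)%N.
Hypothesis lab : forall x y i, c x y = Some i -> lx i x = ly i y.
Variables (A0 : {set X}) (B0 : {set Y}).
Hypothesis small : forall i l (M : {set X * Y}), matching M ->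
  (forall p, p \in M -> [/\ p.1 \in A0, p.2 \in B0, c p.1 p.2 = Some i & lx i p.1 = l]) ->
  (#|M| <= n)%N.

Variable mu : rat.
Hypothesis emu : mu = 1 / (40 * K%:R).

(** If no colour has too many bad vertices, the edge count contradicts [level_count]. Otherwise a
    colour is deleted, and the side opposite to its bad vertices gains a level. *)
Lemma stage_dichotomy u (A : {set X}) (B : {set Y}) (I : {set 'I_k}) la lb :
  A \subset A0 -> B \subset B0 ->
  #|I| = u.+2 -> (la + lb + u)%N = K -> (la <= 3)%N -> (lb <= 3)%N ->
  level K la <= sz n A - 2 * u%:R -> level K lb <= sz n B - 2 * u%:R ->
  sz n A <= 2 * K%:R + 2 -> region n mu c A B I ->
  exists i, exists A' : {set X}, exists B' : {set Y},
    [/\ i \in I, A' \subset A, B' \subset B & region n mu c A' B' (I :\ i)] /\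
    exists la' lb', [/\ (la' + lb')%N = (la + lb).+1, (la' <= 3)%N, (lb' <= 3)%N,
      level K la' <= sz n A' - 2 * (u%:R - 1) &
      level K lb' <= sz n B' - 2 * (u%:R - 1)].
Proof.
move=> sA sB cI eK la3 lb3 hA hB leA regAB.
have mu0 : 0 <= mu by rewrite emu; apply: divr_ge0; [exact: ler01 | apply: mulr_ge0; exact: ler0n].
have eKs : (lb + la + u)%N = K by rewrite (addnC lb).
have [mA tA] := level_degree K6 eKs lb3 la3 emu hA.
have [mB tB] := level_degree K6 eK la3 lb3 emu hB.
have cIr : #|I|%:R = u%:R + 2 :> rat by rewrite cI -addn2 natrD.
have small' i l (M : {set X * Y}) : matching M ->
  (forall p, p \in M -> [/\ p.1 \in A, p.2 \in B, c p.1 p.2 = Some i & lx i p.1 = l]) ->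
  (#|M| <= n)%N.
  move=> mM h; apply: (small (i := i) (l := l) mM) => p /h[pA pB ec el].
  by split; [exact: (subsetP sA) | exact: (subsetP sB) | exact: ec | exact: el].
have [S [T cov]] := cover_system_ex n_gt0 lab small'.
have lab' y x i : c x y = Some i -> ly i y = lx i x by move/lab.
have regBA := region_swap regAB; have covBA := cover_system_swap cov.
rewrite -cIr in mA mB.
have [/forallP/= hbad|/forallPn/=[i]] := boolP [forall i, (i \in I) ==>
   (sz n (bad lx A I S i) + sz n (bad ly B I T i) <= 1 + 2 * mu + loss n lx ly A B S T i)].
  have := stage_count lab regAB cov mA mB (fun i => implyP (hbad i)).
  rewrite cIr addrK => cnt.
  by case: (level_count K6 eK la3 lb3 emu hA hB leA cnt).
rewrite negb_imply -ltNge => /andP[iI].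
case/(bad_split mu0 lab regAB cov iI) => hi.
  have [|w [A' [B' [reg' [sA' sB'] [w0 w1 hw] [h1 h2] h3]]]] :=
      double_reduction lab regAB cov iI _ hi; first by rewrite cIr.
  rewrite cIr in hw h2 h3.
  have [lt3 hl] := level_step K6 eK la3 lb3 emu hB w0 w1 hw h3.
  exists i, A', B'; split; first by split.
  exists la, lb.+1; split; [exact: addnS | exact: la3 | exact: lt3 | lra | lra].
rewrite -loss_swap in hi.
have [|w [B' [A' [reg' [sB' sA'] [w0 w1 hw] [h1 h2] h3]]]] :=
    double_reduction lab' regBA covBA iI _ hi; first by rewrite cIr.
rewrite cIr in hw h2 h3.
have [lt3 hl] := level_step K6 eKs lb3 la3 emu hA w0 w1 hw h3.
exists i, A', B'; split.
  by split; [exact: iI | exact: sA' | exact: sB' | exact: region_swap reg'].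
exists la.+1, lb; split; [exact: addSn | exact: lt3 | exact: lb3 | lra | lra].
Qed.

(** Each deletion lowers [u] and raises one level, and levels stop at 3. At [u = 0] one more
    deletion would give levels of sum [K + 1 >= 7]. *)
Lemma no_stage u (A : {set X}) (B : {set Y}) (I : {set 'I_k}) la lb :
  A \subset A0 -> B \subset B0 ->
  #|I| = u.+2 -> (la + lb + u)%N = K -> (la <= 3)%N -> (lb <= 3)%N ->
  level K la <= sz n A - 2 * u%:R -> level K lb <= sz n B - 2 * u%:R ->
  sz n A <= 2 * K%:R + 2 -> region n mu c A B I -> False.
Proof.
elim: u A B I la lb => [|u IH] A B I la lb sA sB cI eK la3 lb3 hA hB leA regAB;
  have [i [A' [B' [[iI sA' sB' reg'] [la' [lb' [e' la'3 lb'3 hA' hB']]]]]]] :=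
    stage_dichotomy sA sB cI eK la3 lb3 hA hB leA regAB.
  clear - K6 eK e' la'3 lb'3; lia.
have eu : u.+1%:R - 1 = u%:R :> rat by rewrite -natr1 addrK.
rewrite eu in hA' hB'.
apply: (IH A' B' (I :\ i) la' lb' (subset_trans sA' sA) (subset_trans sB' sB)
  _ _ la'3 lb'3 hA' hB' (le_trans (szS n sA') leA) reg').
  by rewrite (cardsD1 i) iI in cI; case: cI.
clear - eK e'; lia.
Qed.

Theorem no_small_connected_matchings : k = K.+2 ->
  2 * K%:R + 1 / 2 + 1 / K%:R <= sz n A0 ->
  2 * K%:R + 1 / 2 + 1 / K%:R <= sz n B0 ->
  (forall x, x \in A0 -> sz n [set y in B0 | c x y == None] <= mu) ->
  (forall y, y \in B0 -> sz n [set x in A0 | c x y == None] <= mu) -> False.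
Proof.
move=> ek hA hB mA mB.
have := invK_le K6; have := invK_gt0 K6; have := K6r K6 => k6 i0 i6.
have [A [sA lA gA]] := sz_trim n_gt0 hA; have [B [sB lB gB]] := sz_trim n_gt0 hB.
rewrite max_r in gA gB; last by lra.
have regAB : region n mu c A B setT.
  split=> [x y i _ _ _|x xA|y yB]; first by rewrite inE.
    apply: le_trans (mA x (subsetP sA x xA)); apply: szS; apply/subsetP => y.
    by rewrite !inE => /andP[/(subsetP sB)-> ->].
  apply: le_trans (mB y (subsetP sB y yB)); apply: szS; apply/subsetP => x.
  by rewrite !inE => /andP[/(subsetP sA)-> ->].
have cT : #|[set: 'I_k]| = K.+2 by rewrite cardsT card_ord.
apply: (no_stage sA sB cT (la := 0) (lb := 0) erefl isT isT _ _ _ regAB);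
  rewrite /level; lra.
Qed.

End Main.

(** * Asymptotics *)

Local Close Scope ring_scope.

Lemma matching_card_le (X Y : finType) (M : {set X * Y}) (P : {set X}) : matching M ->
  (forall p, p \in M -> p.1 \in P) -> #|M| <= #|P|.
Proof.
case=> inj _ h; rewrite -(card_in_imset inj); apply: subset_leq_card.
by apply/subsetP => x /imsetP[p pM ->]; apply: h.
Qed.

Lemma good_rows (U U' : finType) (P : {set U}) (P' : {set U'}) (r : U -> U' -> bool) s :
  0 < s -> #|[set p in setX P P' | r p.1 p.2]| * s ^ 2 <= #|P| * #|P'| -> 0 < #|P'| ->
  exists2 A : {set U}, A \subset P & s.-1 * #|P| <= s * #|A| /\
    {in A, forall x, #|[set B in P' | r x B]| * s <= #|P'|}.
Proof.
move=> s0 h P'0; have := few_bad_rows h P'0; set bad := [set A in P | _] => hbad.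
exists (P :\: bad); first exact: subsetDl.
split; last by move=> x; rewrite !inE => /andP[/nandP[/negP|]] //; rewrite -leqNgt.
have sb : bad \subset P by apply/subsetP => x; rewrite inE => /andP[].
have := cardsID bad P; rewrite (setIidPr sb); move: (#|bad|) (#|P :\: bad|) hbad => x y.
by case: (s) s0 => // s' _ /=; nia.
Qed.

Lemma threshold_ratio (R : realFieldType) K : 0 < K ->
  (2 * K%:R + 1 / 2 + 1 / K%:R = (4 * K ^ 2 + K + 2)%:R / (2 * K%:R) :> R)%R.
Proof.
move=> K0; have K0r : (K%:R != 0 :> R)%R by rewrite pnatr_eq0 -lt0n.
by rewrite !natrD !natrM; field; rewrite K0r.
Qed.

Section Arrow.
Variables (k K g : nat).
Hypotheses (kK : k = K.+2) (K6 : 6 <= K) (g0 : 0 < g).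

Section Constants.
(* [F / (2 * K)] is the constant [2 * k - 7 / 2 + 1 / (k - 2)] of the theorem. *)
Variables (F G1 D q : nat).
Hypotheses (eF : F = 4 * K ^ 2 + K + 2).
Hypotheses (hG160 : 160 * F <= G1) (hG3 : 3 * (F * g + 2 * K) <= G1).
Hypotheses (D0 : 0 < D) (eq_q : q = 16 * D * D * G1).

(** Keep the clusters with few missing pairs and let [t] be the largest number for which both kept
    sides have size at least [F/(2 K)] in units of [t]. Then some connected matching has more than
    [t] edges, and [n <= (t + 1) cap] makes room for the cycle. *)
Lemma cycle_arrow N n m (P P' : {set {set 'I_N}}) C (c : edge_colouring k N) :
  trivIset P -> trivIset P' ->
  {in P, forall A : {set 'I_N}, #|A| = m} -> {in P', forall A : {set 'I_N}, #|A| = m} ->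
  N <= C * m -> 4 * F * m <= N ->
  #|~: cover P| * G1 ^ 2 <= N -> #|~: cover P'| * G1 ^ 2 <= N ->
  #|irregular q D (fun x y => c (x, y)) P P'| * G1 ^ 2 <= #|P| * #|P'| ->
  1 < n -> 2 * C * C <= n -> 2 * G1 * (3 + 4 * C * C) + 4 * D <= m ->
  F * g * n + 2 * K * n <= 2 * K * g * N ->
  exists i, has_copy (even_cycle n) (colour_class c i).
Proof.
move=> tP tP' cP cP' NC Nm uP uP' irr n1 hCn hm hN.
have F0 : 0 < F by rewrite eF addn_gt0 orbT.
have G10 : 0 < G1 by apply: leq_trans hG160; rewrite muln_gt0.
have GG1 : G1 <= G1 ^ 2 by rewrite -mulnn leq_pmulr.
have m0 : 0 < m by lia.
have eP := card_cover_const tP cP; have eP' := card_cover_const tP' cP'.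
have cardP : #|P| * m + #|~: cover P| = N by rewrite -eP cardsC card_ord.
have cardP' : #|P'| * m + #|~: cover P'| = N by rewrite -eP' cardsC card_ord.
have hpN (p u : nat) : p * m + u = N -> u * G1 ^ 2 <= N -> G1.-1 * N <= G1 * (p * m).
  move=> e hu; have : u * G1 <= N by apply: leq_trans hu; rewrite leq_mul2l GG1 orbT.
  rewrite -subn1 mulnBl mul1n; have : G1 * (p * m) + u * G1 = G1 * N by rewrite -e; lia.
  by lia.
have PmN : #|P| * m <= N by rewrite -[leqRHS]cardP leq_addr.
have P'mN : #|P'| * m <= N by rewrite -[leqRHS]cardP' leq_addr.
have hP := hpN _ _ cardP uP; have hP' := hpN _ _ cardP' uP'.
have leP : #|P| <= C by rewrite -(leq_pmul2r m0); lia.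
have leP' : #|P'| <= C by rewrite -(leq_pmul2r m0); lia.
have G1big : 160 <= G1 by apply: leq_trans hG160; rewrite leq_pmulr.
have P0 : 0 < #|P| by case: #|P| hP => //; nia.
have P'0 : 0 < #|P'| by case: #|P'| hP' => //; nia.
pose rc := rcol q D c P P'.
have rcN A B : A \in P -> B \in P' -> rc A B == None =
    [forall i, ~~ lower_regular q D (fun x y => c (x, y)) i A B].
  move=> AP BP; rewrite /rc /rcol AP BP /=; case: pickP => [i hi|no].
    by apply/esym/negP => /forallP/(_ i); rewrite hi.
  by apply/esym/forallP => i; rewrite no.
have missP : #|[set p in setX P P' | rc p.1 p.2 == None]| * G1 ^ 2 <= #|P| * #|P'|.
  apply: leq_trans irr; rewrite leq_mul2r; apply/orP; right.
  apply: subset_leq_card; apply/subsetP => p; rewrite !inE => /andP[/andP[h1 h2]].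
  by rewrite h1 h2 rcN.
have missP' : #|[set p in setX P' P | rc p.2 p.1 == None]| * G1 ^ 2 <= #|P'| * #|P|.
  rewrite [leqRHS]mulnC; apply: leq_trans missP; rewrite leq_mul2r; apply/orP; right.
  have swapI : injective (fun p : {set 'I_N} * {set 'I_N} => (p.2, p.1)).
    by move=> [? ?] [? ?] [-> ->].
  rewrite -(card_imset _ swapI); apply: subset_leq_card.
  apply/subsetP => z /imsetP[p]; rewrite !inE => /andP[/andP[h1 h2] h3] ->.
  by rewrite /= h1 h2.
have [A0 sA [hA badA]] := good_rows (r := fun A B => rc A B == None) G10 missP P'0.
have [B0 sB [hB badB]] := good_rows (r := fun B A => rc A B == None) G10 missP' P0.
pose a := minn #|A0| #|B0|.
pose t := 2 * K * a %/ F.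
have tF : F * t <= 2 * K * a by rewrite mulnC leq_trunc_div.
have Ft : 2 * K * a < F * t.+1 by rewrite [F * _]mulnC ltn_ceil.
have hab : G1.-1 * #|P| <= G1 * a \/ G1.-1 * #|P'| <= G1 * a.
  by rewrite /a; case: (leqP #|A0| #|B0|) => _; [left | right].
have G1S : G1.-1.+1 = G1 by rewrite prednK.
have K0 : 0 < K by lia.
have s0 : 0 < G1.-1 by lia.
have tmiss p' : p' * m <= N -> 40 * K * p' <= t * G1.
  move=> hp'; rewrite -G1S.
  case: hab => ha.
    by apply: (@threshold_missing F K _ N m #|P| p' a t); rewrite ?G1S.
  by apply: (@threshold_missing F K _ N m #|P'| p' a t); rewrite ?G1S.
have t0 : 0 < t.
  rewrite lt0n; apply/eqP => t0; have := tmiss _ PmN.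
  by rewrite t0 mul0n leqNgt !muln_gt0 K0 P0.
(* The reserve [h] will be [d + 1]; the choice of [q] makes [G1 d] and [D d] at most [m/16]. *)
pose d := m * D %/ q.
have q0 : 0 < q by rewrite eq_q !muln_gt0 D0 G10.
have hd : 16 * D * G1 * d <= m.
  have le : d * q <= m * D := leq_trunc_div _ _.
  by rewrite -(leq_pmul2r D0); apply: leq_trans le; rewrite eq_q; lia.
have hd' : m * D <= q * d.+1 by rewrite [q * _]mulnC ltnW // ltn_ceil.
pose h := d.+1.
have Gd : 16 * (G1 * d) <= m.
  by apply: leq_trans hd; rewrite mulnA leq_mul2r -mulnA leq_mul2l leq_pmull ?orbT.
have Dd : 16 * (D * d) <= m.
  apply: leq_trans hd; have : D * d * 1 <= D * d * G1 by rewrite leq_mul2l G10 orbT.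
  lia.
(* What a cluster offers for oscillation: [2 h + 1] vertices are kept for the embedding and [4 C^2]
   for travel. *)
pose cap := m - ((2 * h).+1 + 4 * C * C).
have hcapm : (2 * h).+1 + 4 * C * C <= m.
  have : d <= G1 * d by rewrite leq_pmull.
  have : 3 + 4 * C * C <= G1 * (3 + 4 * C * C) by rewrite leq_pmull.
  by rewrite /h; lia.
have hcap : G1.-1 * m <= G1.-1.+1 * cap.
  have : G1 * ((2 * h).+1 + 4 * C * C) <= m.
    have -> : G1 * ((2 * h).+1 + 4 * C * C) = 2 * (G1 * d) + G1 * (3 + 4 * C * C).
      by rewrite /h; clear; lia.
    by move: Gd hm; clear; lia.
  rewrite /cap; move: hcapm; move: ((2 * h).+1 + 4 * C * C) => w _ hw.
  by rewrite G1S mulnBr -subn1 mulnBl mul1n leq_sub2l.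
have ncap : n <= t.+1 * cap.
  case: hab => ha.
    apply: (@threshold_count F (2 * K) g G1.-1 n N m #|P| a); rewrite ?G1S ?muln_gt0 ?K0 //.
      exact: ltnW.
    by rewrite -{2}G1S.
  apply: (@threshold_count F (2 * K) g G1.-1 n N m #|P'| a); rewrite ?G1S ?muln_gt0 ?K0 //.
    exact: ltnW.
  by rewrite -{2}G1S.
apply/existsP; apply: contraT; rewrite negb_exists => /forallP nocopy; exfalso.
pose lx i (A : {set 'I_N}) := component q D c P P' i (inl A).
pose ly i (A : {set 'I_N}) := component q D c P P' i (inr A).
have lab x y i : rc x y = Some i -> lx i x = ly i y by apply: rcol_component.
have small i l (M : {set {set 'I_N} * {set 'I_N}}) : matching M ->
  (forall p, p \in M -> [/\ p.1 \in A0, p.2 \in B0, rc p.1 p.2 = Some i & lx i p.1 = l]) ->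
  #|M| <= t.
  move=> mM hM; rewrite leqNgt; apply/negP => tM; case/negP: (nocopy i).
  have leM : #|M| <= C.
    apply: leq_trans leP; apply: (matching_card_le mM) => p /hM[pA _ _ _].
    exact: (subsetP sA).
  have base : #|M| * (#|P| + #|P'|) <= 2 * C * C.
    by apply: (@leq_trans (C * (C + C))); [apply: leq_mul => //; apply: leq_add | lia].
  apply: (@reduced_matching_cycle N k q D c P P' m tP tP' cP cP' M i l h cap n mM) => //.
  - by move=> p /hM[].
  - by rewrite /h; move: Dd hm; clear; lia.
  - rewrite eq_q; have : 1 * (2 * D) <= (8 * D * G1) * (2 * D).
      by rewrite leq_mul2r !muln_gt0 D0 G10 orbT.
    by clear; lia.
  - exact: leq_trans hCn.
  - by apply: leq_trans ncap _; rewrite leq_mul2r tM orbT.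
  - by move: base hcapm; rewrite /cap; clear; lia.
have K0r : (0 < K%:R :> rat)%R by rewrite ltr0n.
have t0r : (0 < t%:R :> rat)%R by rewrite ltr0n.
have K40 : (0 < 40 * K%:R :> rat)%R by rewrite -natrM ltr0n muln_gt0.
have big (U : finType) (Z : {set U}) : a <= #|Z| ->
    (2 * K%:R + 1 / 2 + 1 / K%:R <= sz t Z)%R.
  move=> le; rewrite /sz ler_pdivlMr //.
  have e : (2 * K%:R + 1 / 2 + 1 / K%:R = F%:R / (2 * K%:R) :> rat)%R.
    by rewrite eF; apply: threshold_ratio.
  rewrite e mulrAC ler_pdivrMr ?mulr_gt0 // -!natrM ler_nat.
  by apply: leq_trans tF _; rewrite mulnC leq_mul2r le orbT.
have miss (U : finType) (Z : {set U}) p' : #|Z| * G1 <= p' -> p' * m <= N ->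
    (sz t Z <= 1 / (40 * K%:R))%R.
  move=> hZ hp'; rewrite /sz (ler_pdivrMr _ _ t0r) mulrAC (ler_pdivlMr _ _ K40) mul1r.
  rewrite -!natrM ler_nat -(leq_pmul2r G10); apply: leq_trans (tmiss _ hp').
  by rewrite mulnAC mulnC leq_mul2l hZ orbT.
apply: (no_small_connected_matchings t0 K6 lab small erefl kK).
- by apply: big; apply: geq_minl.
- by apply: big; apply: geq_minr.
- move=> x xA; apply: (miss _ _ #|P'|) P'mN.
  apply: leq_trans (badA _ xA); rewrite leq_mul2r; apply/orP; right.
  by apply: subset_leq_card; apply/subsetP => y; rewrite !inE => /andP[/(subsetP sB)-> ->].
- move=> y yB; apply: (miss _ _ #|P|) PmN.
  apply: leq_trans (badB _ yB); rewrite leq_mul2r; apply/orP; right.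
  by apply: subset_leq_card; apply/subsetP => x; rewrite !inE => /andP[/(subsetP sA)-> ->].
Qed.

End Constants.

(** The hypothesis on [N] reads [N >= (F/(2 K) + 1/g) n]. The constants are fixed in the order [G1],
    [D], [q], then [C] and [N0] by regularity, and finally the bound on [n]. *)
Theorem cycle_arrows (F := 4 * K ^ 2 + K + 2) : exists n0, forall n N, n0 <= n ->
  F * g * n + 2 * K * n <= 2 * K * g * N -> bip_arrows k (even_cycle n) N.
Proof.
have F2K : 2 * K <= F.
  by rewrite /F; have : K <= K ^ 2 by [rewrite -mulnn leq_pmull //; lia]; lia.
have F2 : 2 <= F by rewrite /F leq_addl.
move eF : F F2K F2 => F' F2K F2.
have [G1 [hG160 hG3]] : exists G1, 160 * F' <= G1 /\ 3 * (F' * g + 2 * K) <= G1.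
  by exists (160 * F' + 3 * (F' * g + 2 * K)); rewrite leq_addr leq_addl.
have G2 : 2 <= G1 ^ 2.
  have G12 : 2 <= G1 by lia.
  by rewrite -mulnn; apply: (@leq_trans (2 * 1)); rewrite // leq_mul // ltnW.
have [D eD] : exists D, D = 8 * k * G1 ^ 2 by exists (8 * k * G1 ^ 2).
have [q eq_q] : exists q, q = 16 * D * D * G1 by exists (16 * D * D * G1).
have D0 : 0 < D by rewrite eD kK muln_gt0 (ltnW G2).
have hD : 8 * k * G1 ^ 2 <= D by rewrite eD.
have [|C [N0 reg]] := @weak_regularity k q D (G1 ^ 2) G2 hD (4 * F'); first by lia.
(* [C M0 <= n <= N <= C m] will give [M0 <= m]. *)
have [M0 eM] : exists M0, M0 = 2 * G1 * (3 + 4 * C * C) + 4 * D.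
  by exists (2 * G1 * (3 + 4 * C * C) + 4 * D).
exists (C * M0 + 2 * C * C + N0 + 2) => n N hn hN.
have nN : n <= N.
  have gK : 0 < 2 * K * g by rewrite !muln_gt0 g0 andbT; lia.
  rewrite -(leq_pmul2l gK); apply: leq_trans hN.
  apply: leq_trans (leq_addr _ _); rewrite leq_mul2r; apply/orP; right.
  by rewrite leq_mul2r F2K orbT.
apply/forallP => c; apply/existsP.
have N0N : N0 <= N by lia.
have Npos : 0 < N by lia.
have [P [P' [m [[tP tP'] [cP cP'] [NC Nm] [uP uP'] irr]]]] :=
  reg N 'I_N 'I_N (fun x y => c (x, y)) N0N Npos (card_ord N) (card_ord N).
apply: (cycle_arrow (esym eF) hG160 hG3 D0 eq_q tP tP' cP cP' NC Nm uP uP' irr _ _ _ hN); try lia.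
have C0 : 0 < C by case: (C) NC Npos => //; lia.
by rewrite -(leq_pmul2l C0) -eM; lia.
Qed.

End Arrow.

(* From the arrow relation to bounds with an [o(1)] term *)
From mathcomp Require Import all_classical all_reals all_analysis.
Import numFieldNormedType.Exports.
Local Open Scope classical_set_scope.
Local Open Scope ring_scope.

Lemma bip_ramsey_le k (H : bip_graph) N : bip_arrows k H N -> (bip_ramsey k H <= N)%N.
Proof. by rewrite /bip_ramsey => arr; case: ex_minnP => m _; apply. Qed.

Lemma path_arrows k n N : bip_arrows k (even_cycle n) N ->
  bip_arrows k (bip_path (2 * n)) N.
Proof.
move=> /forallP arr; apply/forallP => c; have /existsP[i hi] := arr c.
by apply/existsP; exists i; apply: has_copy_trans hi; apply: has_copy_path_cycle.
Qed.

(** [o n] is the positive part of the excess. For given [e] take [g >= 2/e]: the hypothesis, with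
    rounding of [N], bounds the excess by [1/g + 1/n], at most [e] once [n >= g]. *)
Lemma eventual_upper_bound (R : realType) (F L : nat) (r : nat -> nat) :
  (0 < L)%N ->
  (forall g, (0 < g)%N -> exists n0, forall n N, (n0 <= n)%N ->
     (F * g * n + L * n <= L * g * N)%N -> (r n <= N)%N) ->
  exists o : R^nat, o @ \oo --> (0 : R) /\
    forall n, (0 < n)%N -> (r n)%:R <= (F%:R / L%:R + o n) * n%:R.
Proof.
move=> L0 hr; exists (fun n => Num.max 0 ((r n)%:R / n%:R - F%:R / L%:R)); split; last first.
  move=> n n0; rewrite -ler_pdivrMr ?ltr0n // -lerBlDl le_max lexx.
  by rewrite orbT.
apply/cvgrPdist_le => e e0.
pose g := (Num.bound (2 / e)).+1.
have [n0 hn0] := hr g isT.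
exists (maxn g n0) => // n /=; rewrite geq_max => /andP[gn n0n].
have npos : (0 < n)%N by apply: leq_trans gn.
rewrite sub0r normrN ger0_norm ?le_max ?lexx // ge_max ltW //=.
pose N := ((F * g * n + L * n) %/ (L * g)).+1.
have Lg0 : (0 < L * g)%N by rewrite muln_gt0 L0.
have hN : (F * g * n + L * n <= L * g * N)%N by rewrite [(L * g * N)%N]mulnC ltnW // ltn_ceil.
have rN := hn0 n N n0n hN.
have hN' : (L * g * N <= F * g * n + L * n + L * g)%N.
  by rewrite [(L * g * N)%N]mulnC mulSn addnC leq_add2r leq_trunc_div.
have Lr : 0 < L%:R :> R by rewrite ltr0n.
have gr : 0 < g%:R :> R by rewrite ltr0n.
have nr : 0 < n%:R :> R by rewrite ltr0n.
have g2 : 2 / e <= g%:R.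
  have /archi_boundP/ltW/le_trans-> // : 0 <= 2 / e by rewrite divr_ge0 // ltW.
  by rewrite ler_nat.
have ge2 : 2 / g%:R <= e by rewrite ler_pdivrMr // mulrC -ler_pdivrMr.
have ng : n%:R^-1 <= g%:R^-1 :> R by rewrite lef_pV2 ?posrE // ler_nat.
have key : (L * g * r n <= F * g * n + L * n + L * g)%N.
  by apply: leq_trans hN'; rewrite leq_mul2l rN orbT.
have {}key : L%:R * g%:R * (r n)%:R <= F%:R * g%:R * n%:R + L%:R * n%:R + L%:R * g%:R :> R.
  by rewrite -!natrM -!natrD ler_nat.
have : (r n)%:R / n%:R - F%:R / L%:R <= g%:R^-1 + n%:R^-1 :> R.
  rewrite lerBlDr ler_pdivrMr //.
  have -> : (g%:R^-1 + n%:R^-1 + F%:R / L%:R) * n%:R =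
     (F%:R * g%:R * n%:R + L%:R * n%:R + L%:R * g%:R) / (L%:R * g%:R) :> R.
    by field; rewrite !gt_eqF.
  by rewrite ler_pdivlMr ?mulr_gt0 // mulrC.
lra.
Qed.

Theorem theorem3 (R : realType) (k : nat) (hk : (8 <= k)%N) :
  (exists o : R^nat, o @ \oo --> (0 : R) /\
     forall n : nat, (2 <= n)%N ->
       (bip_ramsey k (even_cycle n))%:R
         <= (2 * k%:R - 7 / 2 + 1 / (k%:R - 2) + o n) * n%:R) /\
  (exists o : R^nat, o @ \oo --> (0 : R) /\
     forall n : nat, (1 <= n)%N ->
       (bip_ramsey k (bip_path (2 * n)))%:R
         <= (2 * k%:R - 7 / 2 + 1 / (k%:R - 2) + o n) * n%:R).
Proof.
have [K kK] : exists K, k = K.+2 by exists (k - 2)%N; lia.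
have K6 : (6 <= K)%N by lia.
(* With [K = k - 2] the constant is [2 K + 1/2 + 1/K], the ratio in [cycle_arrows]. *)
have -> : 2 * k%:R - 7 / 2 + 1 / (k%:R - 2) =
    (4 * K ^ 2 + K + 2)%:R / (2 * K)%:R :> R.
  have -> : k%:R = K%:R + 2 :> R by rewrite kK -addn2 natrD.
  rewrite natrM -threshold_ratio; last by lia.
  by rewrite addrK mulrDr; lra.
have K20 : (0 < 2 * K)%N by lia.
have arr g (g0 : (0 < g)%N) := cycle_arrows kK K6 g0.
split.
  have [|err [err0 herr]] := @eventual_upper_bound R (4 * K ^ 2 + K + 2) (2 * K)
      (fun n => bip_ramsey k (even_cycle n)) K20.
    move=> g g0; have [n0 h] := arr g g0; exists n0 => n N n0n hN.
    exact/bip_ramsey_le/h.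
  by exists err; split=> // n n2; apply: herr; apply: ltnW.
have [|err [err0 herr]] := @eventual_upper_bound R (4 * K ^ 2 + K + 2) (2 * K)
    (fun n => bip_ramsey k (bip_path (2 * n))) K20.
  move=> g g0; have [n0 h] := arr g g0; exists n0 => n N n0n hN.
  exact/bip_ramsey_le/path_arrows/h.
by exists err.
Qed.
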